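(* Let $M$ be a $kQ$-module with dimension vector $\underline m$, let $P$ be a projective $k\widetilde Q$-module, and let $I=\nu(P)$, where $\nu=\mathrm{D}\mathrm{Hom}_{k\widetilde Q}(-,k\widetilde Q)$ is the Nakayama functor. Suppose that $\dim_k\mathrm{Hom}_{k\widetilde Q}(P,M)=\dim_k\mathrm{Hom}_{k\widetilde Q}(M,I)=1$. Fix nonzero morphisms $f:P\to M$ and $g:M\to I$, with induced exact sequences $$0\to P'\to P\xrightarrow{f}M\to A\to 0,\qquad 0\to B\to M\xrightarrow{g}I\to I'\to 0 ,$$ and set $E=B\oplus I'[-1]$ and $E'=A\oplus P'[1]$ in $\mathcal C_{\widetilde Q}$. Assume that $\mathrm{Hom}_{k\widetilde Q}(B,I')=\mathrm{Hom}_{k\widetilde Q}(P',A)=0$. Then $$X_{\tau P}X_{M}=q^{\frac{1}{2}\Lambda(\underline{\dim}P/\mathrm{rad} P,\,-(\widetilde{I}-\widetilde{R})\underline{m})}X_E+q^{\frac{1}{2}\Lambda(\underline{\dim}P/\mathrm{rad}P,\,-(\widetilde{I}-\widetilde{R})\underline{m})-\frac{1}{2}}X_{E'} .$$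
   Context: Let $k$ be a finite field with $|k|=q$ (with a fixed square root $q^{1/2}$), let $m\ge n$ be positive integers, and let $\widetilde Q$ be an acyclic quiver with vertex set $\{1,\dots,m\}$; the vertices $n+1,\dots,m$ are called frozen, and $Q$ is the full subquiver on $\{1,\dots,n\}$. Modules are finite-dimensional, with the convention that $\dim_k\mathrm{Ext}^1_{k\widetilde Q}(S_i,S_j)$ is the number of arrows $j\to i$, where $S_i$ is the simple module at $i$. A $kQ$-module is viewed as a $k\widetilde Q$-module supported on $\{1,\dots,n\}$, and its dimension vector is regarded as a column vector in $\mathbb Z^n$. Matrices ($m\times n$): $\widetilde B=(b_{ij})$ with $b_{ij}=\#\{i\to j\}-\#\{j\to i\}$; $\widetilde R=(\widetilde r_{ij})$ with $\widetilde r_{ij}=\dim_k\mathrm{Ext}^1_{k\widetilde Q}(S_i,S_j)$; $\widetilde I=\begin{bmatrix}I_n\\0\end{bmatrix}$. It is assumed that there is an antisymmetric integer $m\times m$ matrix $\Lambda$ with $\Lambda(-\widetilde B)=\widetilde I$, and such a $\Lambda$ is fixed; write $\Lambda(a,b)=a^{tr}\Lambda b$ for $a,b\in\mathbb Z^m$. $\mathcal T$ is the $\mathbb Z[q^{\pm1/2}]$-algebra with basis $\{X^e: e\in\mathbb Z^m\}$ and multiplication $X^eX^f=q^{\Lambda(e,f)/2}X^{e+f}$. $\langle M,N\rangle=\dim_k\mathrm{Hom}(M,N)-\dim_k\mathrm{Ext}^1(M,N)$ is the Euler form, which depends only on dimension vectors and extends bilinearly to them. The cluster category $\mathcal C_{\widetilde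 Q}$ is the orbit category of $\mathcal D^b(k\widetilde Q)$ by $\tau\circ[-1]$, with $\tau$ the Auslander-Reiten translation; in it $\tau P\cong P[1]\cong I[-1]$ whenever $P$ is projective, $I$ is injective and $\mathrm{soc}\,I\cong P/\mathrm{rad}\,P$ (equivalently $I\cong \nu(P)$). Quantum Caldero-Chapoton map: for a $kQ$-module $M$ with dimension vector $\underline m$ and a projective $k\widetilde Q$-module $P$, $$X_{M\oplus P[1]}=\sum_{\underline e}|\mathrm{Gr}_{\underline e}M|\,q^{-\frac12\langle\underline e,\underline m-\underline e\rangle}X^{\widetilde B\underline e-(\widetilde I-\widetilde R)\underline m+\underline{\dim}\,P/\mathrm{rad}P}\in\mathcal T,$$ where $\mathrm{Gr}_{\underline e}M$ is the set of submodules of $M$ of dimension vector $\underline e$. For $I$ injective, $X_{M\oplus I[-1]}:=X_{M\oplus P[1]}$, where $P/\mathrm{rad}P\cong\mathrm{soc}\,I$. In particular $X_{\tau P}=X_{P[1]}=X^{\underline{\dim}P/\mathrm{rad}P}$. *)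

(* Defs.v *)
From HB Require Import structures.
From mathcomp Require Import all_boot all_order all_fingroup all_algebra all_field.
From mathcomp Require Import boolp finmap monalg.

Set Implicit Arguments.
Unset Strict Implicit.
Unset Printing Implicit Defensive.

Import GRing.Theory Num.Theory.
Local Open Scope ring_scope.

(* A fixed square root of |k| in the algebraic complex numbers. *)
Record sqrt_card (k : finFieldType) := SqrtCard {
  qhalf :> algC;
  qhalfP : qhalf ^+ 2 = #|k|%:R
}.

(* Z[q^(1/2), q^(-1/2)] is the set of integer Laurent polynomials in a square
   root v of q, as a subring of the algebraic complex numbers. *)
Section LaurentRing.
Variables (k : finFieldType) (v : sqrt_card k).

Definition laurent : {pred algC} := fun x =>
  `[< exists s : seq (int * int), x = \sum_(c <- s) c.1%:~R * (v : algC) ^ c.2 >].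

Lemma laurentP x :
  reflect (exists s : seq (int * int), x = \sum_(c <- s) c.1%:~R * (v : algC) ^ c.2)
          (x \in laurent).
Proof. exact: asboolP. Qed.

Lemma qhalf_neq0 : (v : algC) != 0.
Proof.
apply/eqP=> v0; have := qhalfP v; rewrite v0 expr0n /= => /esym/eqP.
by rewrite pnatr_eq0 -leqn0 leqNgt (cardD1 0) inE.
Qed.

Lemma laurent_subring : subring_closed laurent.
Proof.
split.
- by apply/laurentP; exists [:: (1, 0)]; rewrite big_seq1 expr0z mulr1.
- move=> x y /laurentP[s ->] /laurentP[t ->]; apply/laurentP.
  exists (s ++ [seq (- c.1, c.2) | c <- t]).
  rewrite big_cat big_map /= -sumrN; congr (_ + _).
  by apply: eq_bigr => c _; rewrite rmorphN mulNr.
- move=> x y /laurentP[s ->] /laurentP[t ->]; apply/laurentP.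
  exists [seq (c.1 * d.1, c.2 + d.2) | c <- s, d <- t].
  rewrite mulr_suml big_allpairs_dep /=; apply: eq_bigr => c _.
  rewrite mulr_sumr; apply: eq_bigr => d _.
  by rewrite rmorphM /= expfzDr ?qhalf_neq0 // mulrACA.
Qed.

HB.instance Definition _ :=
  GRing.isSubringClosed.Build algC laurent laurent_subring.

Record Zqhalf := MkZqhalf { zq_val : algC; zq_valP : zq_val \in laurent }.

HB.instance Definition _ := [isSub for zq_val].
HB.instance Definition _ := [Choice of Zqhalf by <:].
HB.instance Definition _ := [SubChoice_isSubComNzRing of Zqhalf by <:].

Lemma laurent_exp z : (v : algC) ^ z \in laurent.
Proof. by apply/laurentP; exists [:: (1, z)]; rewrite big_seq1 mul1r. Qed.

(* [qpow z] is q^(z/2). *)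
Definition qpow (z : int) : Zqhalf := MkZqhalf (laurent_exp z).

Lemma qpow0 : qpow 0 = 1.
Proof. by apply: val_inj; rewrite /= expr0z. Qed.

Lemma qpowD a b : qpow (a + b) = qpow a * qpow b.
Proof. by apply: val_inj; rewrite /= expfzDr ?qhalf_neq0. Qed.

End LaurentRing.

(* The quantum torus: finitely supported functions on Z^m with values in
   Z[q^(1/2), q^(-1/2)], with X^e X^f = q^(Lam(e,f)/2) X^(e+f). *)

Definition lform (m : nat) (Lam : 'M[int]_m) (e f : 'cV[int]_m) : int :=
  (e^T *m Lam *m f) 0 0.

Definition qtorus (k : finFieldType) (v : sqrt_card k) (m : nat)
  (Lam : 'M[int]_m) : Type := {malg (Zqhalf v)['cV[int]_m]}.

Section QTorus.
Variables (k : finFieldType) (v : sqrt_card k) (m : nat) (Lam : 'M[int]_m).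

Local Notation T := (qtorus v Lam).
Local Notation R := (Zqhalf v).
Local Notation L := (lform Lam).
Implicit Types (g : {malg R['cV[int]_m]}) (e f : 'cV[int]_m).

HB.instance Definition _ := GRing.Lmodule.copy T {malg R['cV[int]_m]}.

Definition Xmon e : T := << e >>.

Definition qtmul (g1 g2 : T) : T :=
  \sum_(e <- msupp g1) \sum_(f <- msupp g2)
    << mcoeff e g1 * mcoeff f g2 * qpow v (L e f) *g e + f >>.

Lemma lformDl e1 e2 f : L (e1 + e2) f = L e1 f + L e2 f.
Proof. by rewrite /lform linearD /= !mulmxDl mxE. Qed.

Lemma lformDr e f1 f2 : L e (f1 + f2) = L e f1 + L e f2.
Proof. by rewrite /lform mulmxDr mxE. Qed.

Lemma lform0l f : L 0 f = 0.
Proof. by rewrite /lform trmx0 !mul0mx mxE. Qed.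

Lemma lform0r e : L e 0 = 0.
Proof. by rewrite /lform mulmx0 mxE. Qed.

Lemma qtmulw (d1 d2 : {fset 'cV[int]_m}) g1 g2 :
  (msupp g1 `<=` d1)%fset -> (msupp g2 `<=` d2)%fset ->
  qtmul g1 g2 = \sum_(e <- d1) \sum_(f <- d2)
    << mcoeff e g1 * mcoeff f g2 * qpow v (L e f) *g e + f >>.
Proof.
move=> le_d1 le_d2; rewrite /qtmul (big_fset_incl _ le_d1) /=.
  apply: eq_bigr => e _; apply/big_fset_incl => // f _ /mcoeff_outdom ->.
  by rewrite mulr0 mul0r monalgU0.
move=> e _ /mcoeff_outdom g1e.
by rewrite big1 => // f _; rewrite g1e !mul0r monalgU0.
Qed.

Lemma qtmulUU c1 c2 e f :
  qtmul << c1 *g e >> << c2 *g f >> = << c1 * c2 * qpow v (L e f) *g e + f >>.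
Proof. by rewrite (qtmulw msuppU_le msuppU_le) !big_seq_fset1 !mcoeffUU. Qed.

Lemma qtmulDl : left_distributive qtmul +%R.
Proof.
move=> g1 g2 g.
rewrite (qtmulw (msuppD_le g1 g2) (fsubset_refl _)).
rewrite (qtmulw (fsubsetUl (msupp g1) (msupp g2)) (fsubset_refl (msupp g))).
rewrite (qtmulw (fsubsetUr (msupp g1) (msupp g2)) (fsubset_refl (msupp g))).
rewrite -big_split /=; apply: eq_bigr => e _.
rewrite -big_split /=; apply: eq_bigr => f _.
by rewrite mcoeffD !mulrDl monalgUD.
Qed.

Lemma qtmulDr : right_distributive qtmul +%R.
Proof.
move=> g g1 g2.
rewrite (qtmulw (fsubset_refl _) (msuppD_le g1 g2)).
rewrite (qtmulw (fsubset_refl (msupp g)) (fsubsetUl (msupp g1) (msupp g2))).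
rewrite (qtmulw (fsubset_refl (msupp g)) (fsubsetUr (msupp g1) (msupp g2))).
rewrite -big_split /=; apply: eq_bigr => e _.
rewrite -big_split /=; apply: eq_bigr => f _.
by rewrite mcoeffD mulrDr mulrDl monalgUD.
Qed.

Lemma qtmul0g : left_zero 0 qtmul.
Proof. by move=> g; rewrite /qtmul msupp0 big_seq_fset0. Qed.

Lemma qtmulg0 : right_zero 0 qtmul.
Proof.
by move=> g; rewrite /qtmul big1 // => e _; rewrite msupp0 big_seq_fset0.
Qed.

Lemma qtmul_suml I (r : seq I) (F : I -> T) g :
  qtmul (\sum_(i <- r) F i) g = \sum_(i <- r) qtmul (F i) g.
Proof.
exact: (big_morph (qtmul^~ g) (fun x y => qtmulDl x y g) (qtmul0g g)).
Qed.

Lemma qtmul_sumr I (r : seq I) (F : I -> T) g :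
  qtmul g (\sum_(i <- r) F i) = \sum_(i <- r) qtmul g (F i).
Proof.
exact: (big_morph (qtmul g) (fun x y => qtmulDr g x y) (qtmulg0 g)).
Qed.

Lemma qtmulA : associative qtmul.
Proof.
move=> g1 g2 g3; rewrite [g1]monalgE (qtmul_suml _ _ (qtmul _ _)) (qtmul_suml _ _ g2).
rewrite (qtmul_suml _ _ g3); apply: eq_bigr => e _.
rewrite [g2]monalgE (qtmul_suml _ _ g3) qtmul_sumr.
rewrite [X in _ = qtmul X _]qtmul_sumr (qtmul_suml _ _ g3).
apply: eq_bigr => f _.
rewrite [g3]monalgE [X in qtmul _ X = _]qtmul_sumr [LHS]qtmul_sumr.
rewrite [RHS]qtmul_sumr; apply: eq_bigr => h _.
rewrite !qtmulUU lformDl lformDr addrA !qpowD; congr << _ *g _ >>.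
rewrite -!mulrA; congr (_ * (_ * _)).
by rewrite [qpow v _ * (_ * _)]mulrC -mulrA mulrCA.
Qed.

Lemma qtmul1g : left_id (Xmon 0) qtmul.
Proof.
move=> g; rewrite [g]monalgE qtmul_sumr; apply: eq_bigr => e _.
by rewrite qtmulUU lform0l qpow0 mul1r mulr1 add0r.
Qed.

Lemma qtmulg1 : right_id (Xmon 0) qtmul.
Proof.
move=> g; rewrite [g]monalgE qtmul_suml; apply: eq_bigr => e _.
by rewrite qtmulUU lform0r qpow0 !mulr1 addr0.
Qed.

Lemma Xmon0_neq0 : Xmon 0 != 0.
Proof. by rewrite /Xmon monalgU_eq0 oner_eq0. Qed.

HB.instance Definition _ := GRing.Zmodule_isNzRing.Build T
  qtmulA qtmul1g qtmulg1 qtmulDl qtmulDr Xmon0_neq0.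

Lemma qtscale_l (c : R) (g : T) : c *: g = qtmul << c *g 0 >> g.
Proof.
rewrite [g in RHS]monalgE qtmul_sumr; apply: eq_bigr => e _.
by rewrite qtmulUU lform0l qpow0 mulr1 add0r.
Qed.

Lemma qtscale_r (c : R) (g : T) : c *: g = qtmul g << c *g 0 >>.
Proof.
rewrite [g in RHS]monalgE qtmul_suml; apply: eq_bigr => e _.
by rewrite qtmulUU lform0r qpow0 mulr1 addr0 mulrC.
Qed.

Lemma qtscaleU (c d : R) e : c *: (<< d *g e >> : T) = << c * d *g e >>.
Proof. by rewrite qtscale_l qtmulUU lform0l qpow0 mulr1 add0r. Qed.

Lemma qtscaleAl (c : R) (g1 g2 : T) : c *: (g1 * g2) = (c *: g1) * g2.
Proof. by rewrite !qtscale_l; apply: qtmulA. Qed.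

HB.instance Definition _ := GRing.Lmodule_isLalgebra.Build R T qtscaleAl.

Lemma qtscaleAr (c : R) (g1 g2 : T) : c *: (g1 * g2) = g1 * (c *: g2).
Proof. by rewrite !qtscale_r; apply/esym/qtmulA. Qed.

HB.instance Definition _ := GRing.Lalgebra_isAlgebra.Build R T qtscaleAr.

Lemma XmonM e f : Xmon e * Xmon f = qpow v (L e f) *: Xmon (e + f).
Proof.
change (qtmul (Xmon e) (Xmon f) = qpow v (L e f) *: Xmon (e + f)).
by rewrite qtmulUU qtscaleU !mul1r mulr1.
Qed.

End QTorus.

Record quiver (m : nat) := Quiver {
  arrow :> finType;
  src : arrow -> 'I_m;
  tgt : arrow -> 'I_m
}.

Section Modules.
Variables (k : finFieldType) (m : nat) (Q : quiver m).

(* A word is a vertex followed by a list of arrows. The word (i, [:: a1; ..; ar])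
   is a path when tgt a1 = i and tgt a(l+1) = src al, so that arrows are listed
   from the last one traversed to the first one, and the path goes from
   [wend i [:: a1; ..; ar]] to i. *)
Fixpoint walk (i : 'I_m) (s : seq Q) : bool :=
  if s is a :: s' then (tgt a == i) && walk (src a) s' else true.

Definition wend (i : 'I_m) (s : seq Q) : 'I_m := last i [seq src a | a <- s].

Definition acyclic : Prop :=
  forall i s, walk i s -> wend i s = i -> s = [::].

(* The path algebra is generated by the idempotents of the vertices and by the
   arrows. With the words above concatenated from left to right, an arrow
   a : i -> j satisfies e_j a e_i = a. *)
Definition pgen := ('I_m + arrow Q)%type.

Definition prel (d : nat) (X : pgen -> 'M[k]_d) : bool :=
  [&& [forall i : 'I_m, [forall j : 'I_m,
         X (inl i) *m X (inl j) == (if i == j then X (inl i) else 0)]],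
      \sum_(i < m) X (inl i) == 1%:M
    & [forall a : Q,
         X (inl (tgt a)) *m X (inr a) *m X (inl (src a)) == X (inr a)]].

(* Finite-dimensional modules over the path algebra: the generators act on the
   right of the row space k^d. In particular an arrow i -> j maps the component
   of the module at j to the component at i; see [dimExt1_simple]. *)
Record kmod := Kmod {
  mdim : nat;
  mact : pgen -> 'M[k]_mdim;
  mactP : prel mact
}.

Definition is_hom (M N : kmod) (F : 'M[k]_(mdim M, mdim N)) : bool :=
  [forall x, F *m mact N x == mact M x *m F].

Definition Hom (M N : kmod) : {vspace 'M[k]_(mdim M, mdim N)} :=
  <<enum (@is_hom M N)>>%VS.

Definition dimHom (M N : kmod) : nat := \dim (Hom M N).

(* Ext^1(M, N) as extensions of M by N modulo equivalence: an extension is a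
   module structure on N (+) M with N as submodule and M as quotient, and the
   equivalences of extensions are the automorphisms block_mx 1 0 F 1. *)
Definition ext_cocycle (M N : kmod) (c : {ffun pgen -> 'M[k]_(mdim M, mdim N)}) :=
  prel (fun x => block_mx (mact N x) 0 (c x) (mact M x)).

Definition ext_coboundary (M N : kmod)
    (c : {ffun pgen -> 'M[k]_(mdim M, mdim N)}) : bool :=
  [exists F : 'M[k]_(mdim M, mdim N),
     [forall x, c x == F *m mact N x - mact M x *m F]].

Definition dimExt1 (M N : kmod) : nat :=
  (\dim <<enum (@ext_cocycle M N)>> - \dim <<enum (@ext_coboundary M N)>>)%N.

Definition projective (P : kmod) : Prop :=
  forall (L N : kmod) (g : 'M[k]_(mdim L, mdim N)) (h : 'M[k]_(mdim P, mdim N)),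
    is_hom g -> row_full g -> is_hom h ->
    exists2 h' : 'M[k]_(mdim P, mdim L), is_hom h' & h' *m g = h.

Definition exact4 (K M N C : kmod) (u : 'M[k]_(mdim K, mdim M))
    (f : 'M[k]_(mdim M, mdim N)) (p : 'M[k]_(mdim N, mdim C)) : Prop :=
  [/\ [/\ is_hom u, is_hom f & is_hom p],
      row_free u, (u :=: kermx f)%MS, (f :=: kermx p)%MS & row_full p].

(* Submodules are row spaces stable under the generators; [genmx] selects one
   matrix for each row space. *)
Definition is_submod (M : kmod) (U : 'M[k]_(mdim M)) : bool :=
  [forall x, stablemx U (mact M x)].

Definition submods (M : kmod) : {set 'M[k]_(mdim M)} :=
  [set U | (<<U>>%MS == U) && is_submod U].

Definition maximal_submod (M : kmod) (U : 'M[k]_(mdim M)) : bool :=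
  [&& U \in submods M, (U < 1%:M)%MS
    & [forall V in submods M, (U < V)%MS ==> (1%:M <= V)%MS]].

Definition simple_submod (M : kmod) (U : 'M[k]_(mdim M)) : bool :=
  [&& U \in submods M, U != 0
    & [forall V in submods M, (V < U)%MS ==> (V == 0)]].

Definition rad (M : kmod) : 'M[k]_(mdim M) :=
  (\bigcap_(U | @maximal_submod M U) U)%MS.

Definition soc (M : kmod) : 'M[k]_(mdim M) :=
  (\sum_(U | @simple_submod M U) U)%MS.

Definition dimv_sub (M : kmod) (U : 'M[k]_(mdim M)) : 'cV[int]_m :=
  \col_i (\rank (U *m mact M (inl i)))%:Z.

Definition dimv (M : kmod) : 'cV[int]_m := @dimv_sub M 1%:M.

Definition dimv_top (M : kmod) : 'cV[int]_m := dimv M - dimv_sub (rad M).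

(* P / rad P is isomorphic to soc I, expressed by a morphism P -> I with kernel
   rad P and image soc I. *)
Definition top_iso_soc (P I : kmod) : Prop :=
  exists2 h : 'M[k]_(mdim P, mdim I),
    is_hom h & (kermx h :=: rad P)%MS /\ (h :=: soc I)%MS.

Lemma prelP d (X : pgen -> 'M[k]_d) :
  reflect [/\ forall i j, X (inl i) *m X (inl j) = if i == j then X (inl i) else 0,
              \sum_(i < m) X (inl i) = 1%:M
            & forall a, X (inl (tgt a)) *m X (inr a) *m X (inl (src a)) = X (inr a)]
          (prel X).
Proof.
apply: (iffP and3P) => -[h1 h2 h3]; split.
- by move=> i j; have /forallP/(_ i)/forallP/(_ j)/eqP := h1.
- exact/eqP.
- by move=> a; have /forallP/(_ a)/eqP := h3.
- by apply/forallP => i; apply/forallP => j; apply/eqP.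
- exact/eqP.
- by apply/forallP => a; apply/eqP.
Qed.

Lemma is_homP (M N : kmod) (F : 'M[k]_(mdim M, mdim N)) :
  reflect (forall x, F *m mact N x = mact M x *m F) (is_hom F).
Proof. by apply: (iffP forallP) => h x; apply/eqP. Qed.

Lemma mem_span_closed (vT : vectType k) (s : seq vT) :
  0 \in s -> (forall c u v, u \in s -> v \in s -> c *: u + v \in s) ->
  forall v, (v \in <<s>>%VS) = (v \in s).
Proof.
move=> s0 sZD v; apply/idP/idP => [|/memv_span //].
move=> /(coord_span (X := in_tuple s)) ->.
elim/big_ind: _ => // [x y sx sy|i _]; first by rewrite -[x]scale1r sZD.
by rewrite -[_ *: _]addr0 sZD // mem_nth.
Qed.

Lemma memv_Hom (M N : kmod) (F : 'M[k]_(mdim M, mdim N)) :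
  (F \in Hom M N) = is_hom F.
Proof.
rewrite mem_span_closed ?mem_enum //.
  by apply/is_homP => x; rewrite mul0mx mulmx0.
move=> c U V; rewrite !mem_enum => /is_homP hU /is_homP hV; apply/is_homP => x.
by rewrite mulmxDl mulmxDr -scalemxAl -scalemxAr hU hV.
Qed.

Lemma prel0 : prel (fun=> 0 : 'M[k]_0).
Proof. by apply/prelP; split=> *; apply/matrixP => -[]. Qed.

Definition zero_mod : kmod := Kmod prel0.

Lemma prel_simple i : prel (fun x =>
  if x is inl j then ((j == i)%:R%:M : 'M[k]_1) else 0).
Proof.
apply/prelP; split=> [j l||a].
- rewrite -scalar_mxM -natrM mulnb; case: (j =P l) => [<-|ne].
    by rewrite andbb.
  case: (j =P i) ne => [->|_] ne; case: (l =P i) ne => [->|_] ne //;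
    by rewrite /= raddf0.
- rewrite (bigD1 i) //= eqxx big1 ?addr0 // => j /negPf ->.
  by rewrite raddf0.
- by rewrite mulmx0 mul0mx.
Qed.

Definition simple_mod (i : 'I_m) : kmod := Kmod (prel_simple i).

(* The regular bimodule. In an acyclic quiver every path has fewer than m
   arrows, so that bounding the lengths by m leaves no path out. *)
Definition qpath : finType := {u : 'I_m * m.-bseq Q | walk u.1 u.2}.

Definition word := ('I_m * seq Q)%type.

Definition pword (p : 'I_#|qpath|) : word :=
  let u := val (enum_val p) in (u.1, u.2 : seq Q).

Definition gword (x : pgen) : word :=
  match x with inl i => (i, [::]) | inr a => (tgt a, [:: a]) end.

Definition is_cat (u w r : word) : bool :=
  [&& r.1 == u.1, wend u.1 u.2 == w.1 & r.2 == u.2 ++ w.2].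

Definition rmul (x : pgen) : 'M[k]_#|qpath| :=
  \matrix_(p, r) (is_cat (pword p) (gword x) (pword r))%:R.

Definition lmul (x : pgen) : 'M[k]_#|qpath| :=
  \matrix_(p, r) (is_cat (gword x) (pword p) (pword r))%:R.

Arguments pword : simpl never.

Lemma pword_inj : injective pword.
Proof.
move=> p r [e1 e2]; apply: enum_val_inj; apply: val_inj.
rewrite [LHS]surjective_pairing e1 [RHS]surjective_pairing; congr (_, _).
exact: val_inj.
Qed.

Lemma pword_walk p : walk (pword p).1 (pword p).2.
Proof. exact: (valP (enum_val p)). Qed.

Lemma pword_size p : (size (pword p).2 <= m)%N.
Proof. exact: size_bseq. Qed.

Lemma pwordE i s : walk i s -> (size s <= m)%N -> exists p, pword p = (i, s).
Proof.
move=> ws ss; exists (enum_rank (exist _ (i, Bseq ss) ws : qpath)).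
by rewrite /pword enum_rankK.
Qed.

Lemma walk_cat i s t : walk i (s ++ t) = walk i s && walk (wend i s) t.
Proof.
by elim: s i => //= a s IHs i; rewrite IHs andbA.
Qed.

Lemma wend_cat i s t : wend i (s ++ t) = wend (wend i s) t.
Proof. by rewrite /wend map_cat last_cat. Qed.

Lemma pword_eq p r : (pword p).1 = (pword r).1 -> (pword p).2 = (pword r).2 -> p = r.
Proof.
by move=> e1 e2; apply: pword_inj; rewrite [LHS]surjective_pairing e1 e2 -surjective_pairing.
Qed.

Lemma rmulv i :
  rmul (inl i) = diag_mx (\row_p (wend (pword p).1 (pword p).2 == i)%:R).
Proof.
apply/matrixP => p r; rewrite !mxE /is_cat /= cats0.
case: (p =P r) => [->|ne]; first by rewrite !eqxx andbT mulr1n.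
rewrite mulr0n; case: and3P => // -[/eqP e1 _ /eqP e2].
by case: ne; apply: pword_eq.
Qed.

Lemma lmulv i : lmul (inl i) = diag_mx (\row_p ((pword p).1 == i)%:R).
Proof.
apply/matrixP => p r; rewrite !mxE /is_cat /=.
case: (p =P r) => [->|ne].
  by rewrite mulr1n eqxx andbT; case: eqP => [->|//]; rewrite /wend /= eqxx.
rewrite mulr0n; case: and3P => // -[/eqP e1 /eqP e2 /eqP e3].
by case: ne; apply: pword_eq => //; exact: (etrans (esym e2) (esym e1)).
Qed.

Lemma diag_prel (X : pgen -> 'M[k]_#|qpath|) (h : 'I_#|qpath| -> 'I_m) :
  (forall i, X (inl i) = diag_mx (\row_p (h p == i)%:R)) ->
  (forall i j, X (inl i) *m X (inl j) = if i == j then X (inl i) else 0) /\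
  \sum_(i < m) X (inl i) = 1%:M.
Proof.
move=> Xv; split=> [i j|].
  rewrite !Xv mulmx_diag; apply/matrixP => p r; case: ifP => [/eqP <-|ne].
    by rewrite !mxE -natrM mulnb andbb.
  rewrite !mxE -natrM mulnb; case: eqP => [->|]; last by rewrite mul0rn.
  by rewrite ne mul0rn.
apply/matrixP => p r; rewrite summxE (bigD1 (h p)) //= big1 => [|i ne].
  by rewrite Xv !mxE eqxx addr0.
by rewrite Xv !mxE eq_sym (negPf ne) mul0rn.
Qed.

Lemma rmul_prel : prel rmul.
Proof.
have [h1 h2] := diag_prel rmulv; apply/prelP; split=> // a.
rewrite !rmulv; apply/matrixP => p r; rewrite mul_mx_diag mxE mul_diag_mx !mxE.
rewrite -!natrM !mulnb /is_cat /=; congr (nat_of_bool _)%:R.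
case: (wend _ _ =P tgt a); rewrite ?andbF //= => _.
apply/andP/idP => [[] //|/andP[/eqP e1 /eqP e2]]; split; rewrite ?e1 ?e2 ?eqxx //.
by rewrite wend_cat /wend /=.
Qed.

Definition reg_mod : kmod := Kmod rmul_prel.

Lemma lmul_prel :
  [/\ forall i j, lmul (inl i) *m lmul (inl j) = if i == j then lmul (inl i) else 0,
      \sum_(i < m) lmul (inl i) = 1%:M
    & forall a, lmul (inl (src a)) *m lmul (inr a) *m lmul (inl (tgt a)) = lmul (inr a)].
Proof.
have [h1 h2] := diag_prel lmulv; split=> // a.
rewrite !lmulv; apply/matrixP => p r; rewrite mul_mx_diag mxE mul_diag_mx !mxE.
rewrite -!natrM !mulnb /is_cat /wend /= [src a == _]eq_sym.
congr (nat_of_bool _)%:R.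
by case: eqP; rewrite ?andbF //= => _; case: eqP; rewrite //= andbT.
Qed.

Lemma sum_nat_ind (I : finType) (A B : pred I) :
  (forall i j, A i -> A j -> i = j) ->
  \sum_i (A i)%:R * (B i)%:R = [exists i, A i && B i]%:R :> k.
Proof.
move=> A1; case: existsP => [[i /andP[Ai Bi]]|nAB].
  rewrite (bigD1 i) //= Ai Bi mulr1 big1 ?addr0 // => j.
  by case Aj: (A j); rewrite ?mul0r // (A1 j i) ?eqxx.
by rewrite big1 // => i _; rewrite -natrM mulnb; case: andP => // Hi; case: nAB; exists i; apply/andP.
Qed.

Lemma is_cat_inj u w p r : is_cat u w (pword p) -> is_cat u w (pword r) -> p = r.
Proof.
move=> /and3P[/eqP e1 _ /eqP e2] /and3P[/eqP f1 _ /eqP f2].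
by apply: pword_eq; rewrite ?e1 ?e2 ?f1 ?f2.
Qed.

Lemma lmul_rmul x y : lmul x *m rmul y = rmul y *m lmul x.
Proof.
apply/matrixP => p r; rewrite !mxE.
under eq_bigr do rewrite !mxE.
under [RHS]eq_bigr do rewrite !mxE.
rewrite !sum_nat_ind; try by move=> ? ?; apply: is_cat_inj.
congr (nat_of_bool _)%:R; apply/existsP/existsP => -[s /andP[]].
- move=> /and3P[/eqP s1 /eqP s2 /eqP s3] /and3P[/eqP r1 /eqP r2 /eqP r3].
  have wr := pword_walk r; have zr := pword_size r.
  rewrite r1 s1 r3 s3 -catA walk_cat in wr.
  have /andP[_ {}wr] := wr.
  rewrite s2 in wr.
  have [|t tE] := pwordE wr.
    by rewrite (leq_trans _ zr) // r3 s3 -catA [in leqRHS]size_cat leq_addl.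
  exists t; apply/andP; rewrite tE; split; apply/and3P; split; apply/eqP => //.
  - by rewrite -r2 s1 s3 wend_cat s2.
  - by rewrite r1 s1.
  - by rewrite r3 s3 -catA.
- move=> /and3P[/eqP s1 /eqP s2 /eqP s3] /and3P[/eqP r1 /eqP r2 /eqP r3].
  have wr := pword_walk r; have zr := pword_size r.
  rewrite r1 r3 s3 catA walk_cat in wr.
  have /andP[{}wr _] := wr.
  have [|t tE] := pwordE wr.
    by rewrite (leq_trans _ zr) // r3 s3 catA [in leqRHS]size_cat leq_addr.
  exists t; apply/andP; rewrite tE; split; apply/and3P; split; apply/eqP => //.
  - by rewrite r2 s1.
  - by rewrite /= wend_cat r2 s1 s2.
  - by rewrite r3 s3 catA.
Qed.

(* The Nakayama functor P |-> D Hom(P, kQ): the left multiplications of the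
   regular bimodule act on Hom(P, kQ), hence on the right of its dual space. A
   linear form is given by its values on the basis [vbasis (Hom P reg_mod)]. *)
Definition nu_mat (P : kmod) (A : 'M[k]_#|qpath|) : 'M[k]_(dimHom P reg_mod) :=
  \matrix_(l, j) coord (vbasis (Hom P reg_mod)) l
                       ((vbasis (Hom P reg_mod))`_j *m A).

Definition nu_act (P : kmod) (x : pgen) : 'M[k]_(dimHom P reg_mod) :=
  nu_mat P (lmul x).

Lemma Hom_lmul P F x : F \in Hom P reg_mod -> F *m lmul x \in Hom P reg_mod.
Proof.
rewrite !(@memv_Hom P reg_mod) => /(@is_homP P reg_mod) hF.
apply/(@is_homP P reg_mod) => y.
change (F *m lmul x *m rmul y = mact P y *m (F *m lmul x)).
by rewrite -mulmxA lmul_rmul !mulmxA; congr (_ *m _); apply: hF.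
Qed.

Lemma nu_matM P A x : nu_mat P A *m nu_act P x = nu_mat P (lmul x *m A).
Proof.
apply/matrixP => l j; rewrite !mxE.
set b := vbasis _.
have bj : b`_j \in Hom P reg_mod by rewrite vbasis_mem // mem_nth // size_tuple.
rewrite [in RHS]mulmxA [in RHS](coord_vbasis (Hom_lmul x bj)) mulmx_suml linear_sum.
by apply: eq_bigr => r _; rewrite !mxE -scalemxAl linearZ mulrC.
Qed.

Lemma nu_prel P : prel (nu_act P).
Proof.
have [h1 h2 h3] := lmul_prel.
have nu0 : nu_mat P 0 = 0.
  by apply/matrixP => l j; rewrite !mxE mulmx0 linear0.
apply/prelP; split.
- move=> i j; rewrite nu_matM h1 eq_sym; case: eqP => [->|_] //.
- transitivity (nu_mat P (\sum_(i < m) lmul (inl i))).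
    apply/matrixP => l j; rewrite summxE !mxE mulmx_sumr linear_sum.
    by apply: eq_bigr => i _; rewrite mxE.
  rewrite h2; apply/matrixP => l j; rewrite !mxE mulmx1.
  by rewrite coord_free ?(basis_free (vbasisP _)) // eq_sym.
- by move=> a; rewrite !nu_matM mulmxA h3.
Qed.

Definition nu (P : kmod) : kmod := Kmod (nu_prel P).


Lemma ext_cocycleP (M N : kmod) (c : {ffun pgen -> 'M[k]_(mdim M, mdim N)}) :
  reflect [/\ forall i j, c (inl i) *m mact N (inl j) + mact M (inl i) *m c (inl j)
                          = if i == j then c (inl i) else 0,
              \sum_(i < m) c (inl i) = 0
            & forall a, (c (inl (tgt a)) *m mact N (inr a)
                         + mact M (inl (tgt a)) *m c (inr a)) *m mact N (inl (src a))
                        + mact M (inl (tgt a)) *m mact M (inr a) *m c (inl (src a))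
                        = c (inr a)]
          (ext_cocycle c).
Proof.
have [M1 M2 M3] := prelP _ (mactP M); have [N1 N2 N3] := prelP _ (mactP N).
pose X x := block_mx (mact N x) 0 (c x) (mact M x).
have Xsum : \sum_(i < m) X (inl i) = block_mx 1%:M 0 (\sum_(i < m) c (inl i)) 1%:M.
  rewrite -M2 -N2; elim: (index_enum _) => [|i r IHr].
    by rewrite !big_nil block_mx0.
  by rewrite !big_cons IHr add_block_mx addr0.
have X1 i j : X (inl i) *m X (inl j) =
    block_mx (if i == j then mact N (inl i) else 0) 0
      (c (inl i) *m mact N (inl j) + mact M (inl i) *m c (inl j))
      (if i == j then mact M (inl i) else 0).
  by rewrite mulmx_block !(mul0mx, mulmx0, addr0, add0r) N1 M1.
have X3 a : X (inl (tgt a)) *m X (inr a) *m X (inl (src a)) =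
    block_mx (mact N (inr a)) 0
      ((c (inl (tgt a)) *m mact N (inr a) + mact M (inl (tgt a)) *m c (inr a))
         *m mact N (inl (src a))
       + mact M (inl (tgt a)) *m mact M (inr a) *m c (inl (src a)))
      (mact M (inr a)).
  by rewrite !mulmx_block !(mul0mx, mulmx0, addr0, add0r) N3 M3.
apply: (iffP (prelP _)) => -[h1 h2 h3]; split.
- move=> i j; have := h1 i j; rewrite -/(X _) -/(X _) X1; case: eqP => _.
    by move=> /eq_block_mx[].
  by rewrite -[0 in RHS]block_mx0 => /eq_block_mx[].
- by move: h2; rewrite -[LHS]/(\sum_(i < m) X (inl i)) Xsum scalar_mx_block => /eq_block_mx[].
- by move=> a; have := h3 a; rewrite -/(X _) -/(X _) -/(X _) X3 => /eq_block_mx[].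
- by move=> i j; rewrite -/(X _) -/(X _) X1 h1; case: eqP => // _; rewrite block_mx0.
- by rewrite -[LHS]/(\sum_(i < m) X (inl i)) Xsum h2 scalar_mx_block.
- by move=> a; rewrite -/(X _) -/(X _) -/(X _) X3 h3.
Qed.

Lemma mem_cocycles (M N : kmod) c :
  (c \in <<enum (@ext_cocycle M N)>>%VS) = ext_cocycle c.
Proof.
rewrite mem_span_closed ?mem_enum //.
  apply/ext_cocycleP; split=> [i j||a].
  - by rewrite !ffunE mul0mx mulmx0 addr0 if_same.
  - by rewrite big1 // => i _; rewrite ffunE.
  - by rewrite !ffunE !(mul0mx, mulmx0, addr0).
move=> d u v; rewrite !mem_enum => /ext_cocycleP[u1 u2 u3] /ext_cocycleP[v1 v2 v3].
apply/ext_cocycleP; split=> [i j||a].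
- rewrite !ffunE !mulmxDl !mulmxDr -!scalemxAl -!scalemxAr addrACA -scalerDr u1 v1.
  by case: eqP => // _; rewrite scaler0 addr0.
- under eq_bigr do rewrite !ffunE.
  by rewrite big_split /= -scaler_sumr u2 v2 scaler0 addr0.
- rewrite !ffunE -[in RHS]u3 -[in RHS]v3.
  rewrite !(mulmxDl, mulmxDr, scalerDr) -!(scalemxAl, scalemxAr).
  by rewrite [RHS]addrACA; congr (_ + _); rewrite addrACA.
Qed.

Lemma mem_coboundaries (M N : kmod) c :
  (c \in <<enum (@ext_coboundary M N)>>%VS) = ext_coboundary c.
Proof.
rewrite mem_span_closed ?mem_enum //.
  apply/existsP; exists 0; apply/forallP => x.
  by rewrite ffunE mul0mx mulmx0 subr0.
move=> d u v; rewrite !mem_enum => /existsP[F /forallP hF] /existsP[G /forallP hG].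
apply/existsP; exists (d *: F + G); apply/forallP => x.
rewrite !ffunE (eqP (hF x)) (eqP (hG x)) mulmxDl mulmxDr -scalemxAl -scalemxAr.
by rewrite scalerBr opprD addrACA.
Qed.

Lemma coboundary_cocycle (M N : kmod) (c : {ffun pgen -> 'M[k]_(mdim M, mdim N)}) :
  ext_coboundary c -> ext_cocycle c.
Proof.
have [M1 M2 M3] := prelP _ (mactP M); have [N1 N2 N3] := prelP _ (mactP N).
move=> /existsP[F /forallP hF].
have {}hF x : c x = F *m mact N x - mact M x *m F by apply/eqP.
apply/ext_cocycleP; split=> [i j||a].
- rewrite !hF mulmxBl mulmxBr !mulmxA subrKA -[F *m _ *m _]mulmxA N1 M1.
  by case: eqP => // _; rewrite mulmx0 mul0mx subr0.
- under eq_bigr do rewrite hF.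
  by rewrite sumrB -mulmx_sumr -mulmx_suml M2 N2 mulmx1 mul1mx subrr.
- rewrite !hF !(mulmxBl, mulmxBr) !mulmxA subrKA mulmxBl subrKA M3.
  by rewrite -[in RHS]N3 !mulmxA.
Qed.

(* The convention relating arrows and extensions. *)
Lemma dimExt1_simple (i j : 'I_m) :
  dimExt1 (simple_mod i) (simple_mod j)
  = #|[pred a : Q | (src a == j) && (tgt a == i)]|.
Proof.
pose A : pred Q := [pred a : Q | (src a == j) && (tgt a == i)].
rewrite -[RHS]/#|A|.
pose delta (a : Q) : {ffun pgen -> 'M[k]_1} :=
  [ffun x => if x == inr a then 1%:M else 0].
pose s := [seq delta a | a <- enum A].
pose Z := <<enum (@ext_cocycle (simple_mod i) (simple_mod j))>>%VS.
pose B := <<enum (@ext_coboundary (simple_mod i) (simple_mod j))>>%VS.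
have sP (v : {ffun pgen -> 'M[k]_1}) : v \in <<s>>%VS ->
    (forall l, v (inl l) = 0).
  move=> vs l; have := coord_span (X := in_tuple s) vs => ->.
  rewrite sum_ffunE big1 // => r _; rewrite ffunE.
  have /mapP[a _ ->] : s`_r \in s by rewrite mem_nth.
  by rewrite ffunE scaler0.
have BP (v : {ffun pgen -> 'M[k]_1}) a : v \in B -> v (inr a) = 0.
  rewrite (@mem_coboundaries (simple_mod i) (simple_mod j)).
  move=> /existsP[F /forallP/(_ (inr a))/eqP ->].
  by rewrite mulmx0 mul0mx subr0.
have sE (v : {ffun pgen -> 'M[k]_1}) : (forall l, v (inl l) = 0) ->
    (forall a, a \notin A -> v (inr a) = 0) -> v = \sum_(a in A) v (inr a) 0 0 *: delta a.
  move=> v0 vA; apply/ffunP => -[l|a].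
    by rewrite v0 sum_ffunE big1 // => a _; rewrite !ffunE scaler0.
  rewrite sum_ffunE; have [Aa|nAa] := boolP (a \in A); last first.
    rewrite vA // big1 // => b Ab; rewrite !ffunE.
    by case: eqP nAa => [[->]|]; rewrite ?Ab ?scaler0.
  rewrite (bigD1 a) //= big1 => [|b /andP[_ ne]].
    by rewrite addr0 !ffunE eqxx scalemx1 -mx11_scalar.
  rewrite !ffunE; case: (inr a =P inr b) ne => [[->]|]; first by rewrite eqxx.
  by rewrite scaler0.
have free_s : free s.
  rewrite -[s]/(tval (map_tuple delta (enum_tuple A))).
  apply/freeP => c c0 r.
  pose b := tnth (enum_tuple A) r.
  have tE (l : 'I_#|A|) : (map_tuple delta (enum_tuple A))`_l = delta (tnth (enum_tuple A) l).
    by rewrite -tnth_nth tnth_map.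
  move/ffunP/(_ (inr b)): c0; rewrite sum_ffunE (bigD1 r) //= big1 => [|l ne].
    rewrite (tE r) addr0 !ffunE eqxx.
    by move/matrixP/(_ 0 0); rewrite !mxE mulr1.
  rewrite (tE l) !ffunE; case: eqP => [[/esym]|]; last by rewrite scaler0.
  have /tuple_uniqP inj : uniq (enum_tuple A) by apply: enum_uniq.
  by move=> /inj e; rewrite e eqxx in ne.
have ZE : Z = (B + <<s>>)%VS.
  apply/eqP; rewrite eqEsubv; apply/andP; split; last first.
    rewrite subv_add; apply/andP; split.
      by apply/subvP => v; rewrite mem_coboundaries mem_cocycles; apply: coboundary_cocycle.
    apply/span_subvP => v /mapP[a]; rewrite mem_enum => /andP[/eqP sa /eqP ta] ->.
    rewrite (@mem_cocycles (simple_mod i) (simple_mod j)).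
    apply/ext_cocycleP; split=> [l l'||b] /=.
    - by rewrite !ffunE mul0mx mulmx0 addr0 if_same.
    - by rewrite big1 // => l _; rewrite ffunE.
    - rewrite !ffunE !(mul0mx, mulmx0, addr0, add0r) /=.
      case: (inr b =P inr a) => [[->]|_]; last by rewrite mulmx0 mul0mx.
      by rewrite sa ta !eqxx !mulmx1.
  apply/subvP => v; rewrite mem_cocycles => /ext_cocycleP /= [v1 _ v3].
  have {}v1 l l' : (l' == j)%:R *: v (inl l) + (l == i)%:R *: v (inl l')
      = if l == l' then v (inl l) else 0.
    by rewrite -v1 mul_mx_scalar mul_scalar_mx.
  have vE : v = [ffun x => if x is inl _ then v x else 0]
             + [ffun x => if x is inr _ then v x else 0].
    by apply/ffunP => -[l|a]; rewrite !ffunE ?addr0 ?add0r.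
  rewrite vE; apply: memv_add.
    rewrite (@mem_coboundaries (simple_mod i) (simple_mod j)).
    apply/existsP; exists (if i == j then 0 else v (inl j)).
    apply/forallP => -[l|a]; rewrite !ffunE /=; last by rewrite mulmx0 mul0mx subr0.
    rewrite mul_mx_scalar mul_scalar_mx; apply/eqP.
    have := v1 l l; rewrite eqxx.
    case: (i =P j) => [<-|ij] vl.
      rewrite !scaler0 subr0; move: vl.
      case: eqP => _; last by rewrite !scale0r addr0.
      by rewrite scale1r => /eqP; rewrite -subr_eq0 addrK => /eqP.
    have := v1 i j; rewrite !eqxx (introF eqP ij) !scale1r => /eqP.
    rewrite addr_eq0 => /eqP vij; move: vl.
    case: (l =P j) => [->|_].
      by rewrite eq_sym (introF eqP ij) scale0r scale1r subr0.
    case: (l =P i) => [->|_]; first by move=> _; rewrite scale0r scale1r sub0r.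
    by move=> <-; rewrite !scale0r addr0 subr0.
  rewrite (sE [ffun x => _]) => [|l|a nAa]; rewrite ?ffunE //.
    apply: memv_suml => a Aa; apply/memvZ/memv_span/map_f.
    by rewrite mem_enum.
  rewrite -(v3 a) !(mul0mx, mulmx0, addr0, add0r) mul_mx_scalar mul_scalar_mx scalerA.
  by rewrite -natrM mulnb -[_ && _]/(a \in A) (negPf nAa) scale0r.
have BI : (B :&: <<s>> = 0)%VS.
  apply/eqP; rewrite -subv0; apply/subvP => v; rewrite memv_cap => /andP[vB vs].
  rewrite memv0; apply/eqP/ffunP => -[l|a]; rewrite ffunE; first exact: sP.
  exact: BP.
by rewrite /dimExt1 -/Z -/B ZE dimv_disjoint_sum // addKn (eqP free_s) size_map -cardE.
Qed.

End Modules.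

(* From here on the vertices are 0, .., m - 1, those i >= n being frozen. *)
Section ExchangeMatrices.
Variables (k : finFieldType) (m n : nat) (le_nm : (n <= m)%N) (Q : quiver m).

Local Notation w := (widen_ord le_nm).

Definition narrows (i j : 'I_m) : int :=
  #|[pred a : Q | (src a == i) && (tgt a == j)]|%:Z.

Definition Btilde : 'M[int]_(m, n) :=
  \matrix_(i, j) (narrows i (w j) - narrows (w j) i).

Definition Rtilde : 'M[int]_(m, n) :=
  \matrix_(i, j) (dimExt1 (simple_mod k Q i) (simple_mod k Q (w j)))%:Z.

Definition Itilde : 'M[int]_(m, n) := \matrix_(i, j) (val i == val j)%:R.

Definition euler (M N : kmod k Q) : int := (dimHom M N)%:Z - (dimExt1 M N)%:Z.

(* The bilinear form on Z^n extending the Euler form of kQ-modules: it is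
   determined by its values on the dimension vectors of the simple modules,
   which form a basis of Z^n. *)
Definition eulerv (e f : 'cV[int]_n) : int :=
  \sum_(i < n) \sum_(j < n)
    e i 0 * f j 0 * euler (simple_mod k Q (w i)) (simple_mod k Q (w j)).

Definition unfrozen (M : kmod k Q) : Prop :=
  forall i : 'I_m, (n <= i)%N -> mact M (inl i) = 0.

Definition udim (M : kmod k Q) : 'cV[int]_n := rowsub w (dimv M).

Definition Gr (M : kmod k Q) (e : 'cV[int]_n) : {set 'M[k]_(mdim M)} :=
  [set U in submods M | rowsub w (dimv_sub U) == e].

End ExchangeMatrices.

Section CalderoChapoton.
Variables (k : finFieldType) (v : sqrt_card k) (m n : nat) (le_nm : (n <= m)%N).
Variables (Q : quiver m) (Lam : 'M[int]_m).

(* X_(M (+) P[1]). Only vectors e with 0 <= e_i <= dim M have a nonempty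
   Grassmannian, so that the sum over e ranges over these. *)
Definition Xcc (M P : kmod k Q) : qtorus v Lam :=
  \sum_(d : {ffun 'I_n -> 'I_(mdim M).+1})
    let e := \col_i (d i)%:Z in
    (#|Gr le_nm M e|%:R * qpow v (- eulerv k le_nm Q e (udim le_nm M - e)))
      *: Xmon v Lam (Btilde le_nm Q *m e
                     - (Itilde m n - Rtilde k le_nm Q) *m udim le_nm M
                     + dimv_top P).

Definition Xmod (M : kmod k Q) : qtorus v Lam := Xcc M (zero_mod k Q).

Definition Xshift (P : kmod k Q) : qtorus v Lam := Xcc (zero_mod k Q) P.

Lemma XshiftE P : Xshift P = Xmon v Lam (dimv_top P).
Proof.
have u0 : udim le_nm (zero_mod k Q) = 0.
  by apply/colP => i; rewrite !mxE [_ *m _]flatmx0 mxrank0.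
pose d0 : {ffun 'I_n -> 'I_1} := [ffun=> 0].
rewrite /Xshift /Xcc (big_pred1 d0) => [/=|d]; last first.
  by apply/esym/eqP/ffunP => i; rewrite ffunE [d i]ord1.
have -> : \col_i (d0 i)%:Z = 0 :> 'cV[int]_n by apply/colP => i; rewrite !mxE ffunE.
have -> : Gr le_nm (zero_mod k Q) 0 = [set 0].
  apply/setP => U; rewrite !inE [U]flatmx0 eqxx genmx0 eqxx /=; apply/andP; split.
    by apply/forallP => x; rewrite -[stablemx _ _]/(_ <= _)%MS mul0mx mxalgebra.sub0mx.
  by apply/eqP/colP => i; rewrite !mxE mul0mx mxrank0.
rewrite u0 cards1 !(mulmx0, subr0, add0r, mul1r) /eulerv big1 => [|i _].
  by rewrite oppr0 qpow0 scale1r oppr0 add0r.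
by rewrite big1 // => j _; rewrite !mxE !mul0r.
Qed.

End CalderoChapoton.

(* Main.v *)
From HB Require Import structures.
From mathcomp Require Import all_boot all_order all_fingroup all_algebra all_field.
Require Import Defs.

Set Implicit Arguments.
Unset Strict Implicit.
Unset Printing Implicit Defensive.

Import GRing.Theory Num.Theory.
Local Open Scope ring_scope.

(** Both sides are sums over submodules. Write C for the matrix of the Euler
    form on dimension vectors and t for the dimension vector of P / rad P. The
    compatibility of Lambda with the exchange matrix says that moving X^t past
    the term of a submodule U of M costs q^(-(t . dim U) / 2), up to a factor
    common to all U; and t . dim U is the dimension of Hom(P, U), because P is
    projective, so it is 0 or 1. If it is 1 then U contains the image of f, and
    U is the preimage of a submodule of A; if it is 0 then Hom(U, nu P) = 0, so
    U lies in the kernel of g and is a submodule of B [dotv_top_submod],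
    [sub_kermx_submod]. This splits the product into the two sums on the right,
    and it remains to compare exponents.

    The exponents of X agree because C^T sends the dimension vector of a module
    with no extensions by any module to its top [euler_top], and C sends the
    dimension vector of a module with no extensions of any module by it to its
    socle [euler_soc]. These apply to P and to nu P, but also to P' and I':
    vanishing of extensions, phrased as surjectivity of the differential of
    the standard complex [ext_vanish], passes to submodules in the first
    argument and to quotients in the second. The same complex gives the
    dimension of Hom as a value of the Euler form [dimHom_euler].

    The powers of q agree because the differences of the Euler forms involved
    are pairings of nonnegative vectors: t . dim U, just described, and
    soc I' . dim U and top P' . dim (M / U). The last two are bounded by
    soc I' . dim B = dim Hom(B, I') = 0 and top P' . dim A = dim Hom(P', A) = 0,
    hence vanish [dotv_squeeze].

    That nu P has no extensions of any module by it, and socle t, is read off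
    its definition as the dual of Hom(P, kQ). The first arrow of a path can be
    detected and removed, so left multiplications by the arrows are jointly
    injective on Hom(P, kQ); dually the arrows act jointly surjectively on nu P
    [nu_split]. Since the quiver is acyclic, long products of arrows act by
    zero, and this lets one solve the equations of the standard complex by a
    terminating iteration [split_ext_vanish]. The socle of nu P is dual to
    Hom(P, kQ) modulo products of arrows with maps, that is, to the maps from P
    to simple modules [dimHom_nu_simple]. *)

(** * Dimensions of spaces of matrices and of families *)

Section LinearAlgebra.
Variable k : fieldType.

Lemma dimv_linear_image (uT vT : vectType k) (f : {linear uT -> vT})
    (U : {vspace uT}) (V : {vspace vT}) :
  (forall u, u \in U -> f u = 0 -> u = 0) ->
  (forall u, u \in U -> f u \in V) ->
  (forall v, v \in V -> exists2 u, u \in U & v = f u) ->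
  \dim V = \dim U.
Proof.
move=> f_inj fUV fVU; rewrite -(@limg_dim_eq _ _ _ (linfun f) U); last first.
  apply/eqP; rewrite -subv0; apply/subvP => u.
  by rewrite memv_cap memv_ker lfunE memv0 => /andP[Uu /eqP/(f_inj _ Uu) ->].
congr (\dim _); apply/eqP; rewrite eqEsubv; apply/andP; split; apply/subvP => v.
  by move=> /fVU[u Uu ->]; rewrite -[f u]lfunE memv_img.
by move=> /memv_imgP[u Uu ->]; rewrite lfunE fUV.
Qed.

Lemma dimv_rowspace n r (V : {vspace 'rV[k]_n}) (W : 'M[k]_(r, n)) :
  (forall v : 'rV[k]_n, (v \in V) = (v <= W)%MS) -> \dim V = \rank W.
Proof.
move=> VW; transitivity (\dim {: 'rV[k]_(\rank W)}); last by rewrite dimvf /dim /= mul1n.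
apply: (@dimv_linear_image _ _ (mulmxr (row_base W))) => [u _ /= u0|u _ /=|v].
- by apply: (row_free_inj (row_base_free W)); rewrite u0 mul0mx.
- by rewrite VW -(eq_row_base W) submxMl.
- by rewrite VW -(eq_row_base W) => /submxP[u ->]; exists u; rewrite ?memvf.
Qed.

Lemma dimv_colspace n r (V : {vspace 'cV[k]_n}) (W : 'M[k]_(r, n)) :
  (forall v : 'cV[k]_n, (v \in V) = (v^T <= W)%MS) -> \dim V = \rank W.
Proof.
move=> VW; pose tV : {vspace 'rV[k]_n} := (linfun trmx @: V)%VS.
transitivity (\dim tV).
  apply/esym/(@dimv_linear_image _ _ trmx) => [u _ u0|u Vu|_ /memv_imgP[u Vu ->]].
  - by rewrite -[u]trmxK u0 trmx0.
  - by apply/memv_imgP; exists u; rewrite ?lfunE.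
  - by exists u; rewrite ?lfunE.
apply: dimv_rowspace => v; apply/memv_imgP/idP => [[u]|vW].
  by rewrite VW lfunE => uW ->.
by exists v^T; rewrite ?VW ?lfunE /= trmxK.
Qed.

(** Conjugating by bases of the images identifies the space with the
    rectangular matrices of size rank E by rank E'. *)
Lemma dimv_peirce d d' (E : 'M[k]_d) (E' : 'M[k]_d') (V : {vspace 'M[k]_(d, d')}) :
  E *m E = E -> E' *m E' = E' -> (forall X, (X \in V) = (E *m X *m E' == X)) ->
  \dim V = (\rank E * \rank E')%N.
Proof.
move=> EE E'E' VE; transitivity (\dim {: 'M[k]_(\rank E, \rank E')}); last by rewrite dimvf.
have baseK n (F : 'M[k]_n) : F *m F = F -> row_base F *m col_base F = 1%:M.
  move=> FF; apply: (row_free_inj (row_base_free F)); apply: (row_full_inj (col_base_full F)).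
  rewrite mul1mx -[X in col_base F *m X]mulmxA mulmx_base.
  by rewrite [col_base F *m _]mulmxA mulmx_base.
move: {VE}(VE) (baseK _ E EE) (baseK _ E' E'E').
move: (mulmx_base E) (mulmx_base E').
move: (col_base E) (row_base E) (col_base E') (row_base E') => C B C' B'.
move=> defE defE' VE BC BC'.
have {}VE X : (X \in V) = (C *m B *m X *m (C' *m B') == X) by rewrite defE defE'.
apply: (@dimv_linear_image _ _ (mulmx C \o mulmxr B')).
- move=> Y _ /= /(congr1 (fun X => B *m X *m C')).
  by rewrite !mulmxA BC mul1mx -mulmxA BC' mulmx1 mulmx0 mul0mx.
- move=> Y _ /=; rewrite VE !mulmxA -[C *m B *m C]mulmxA BC mulmx1.
  by rewrite -[_ *m B' *m C']mulmxA BC' mulmx1.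
- move=> X; rewrite VE => /eqP XE; exists (B *m X *m C'); first exact: memvf.
  by rewrite /= -{1}XE !mulmxA.
Qed.

Section Product.
Variables (I : finType) (vT : vectType k).

Definition single (i : I) (x : vT) : {ffun I -> vT} :=
  [ffun j => if j == i then x else 0].

Fact single_linear i : linear (single i).
Proof.
move=> c x y; apply/ffunP => j; rewrite !ffunE.
by case: eqP; rewrite // scaler0 addr0.
Qed.
HB.instance Definition _ i :=
  GRing.isLinear.Build k vT {ffun I -> vT} *:%R (single i) (single_linear i).

(** The direct product of the subspaces W i, given as an internal direct sum so
    that its dimension comes from the theory of direct sums. *)
Definition prodv (W : I -> {vspace vT}) : {vspace {ffun I -> vT}} :=
  (\sum_i (linfun (single i) @: W i))%VS.

Lemma sum_single (c : {ffun I -> vT}) : c = \sum_i single i (c i).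
Proof.
apply/ffunP => j; rewrite sum_ffunE (bigD1 j) //= ffunE eqxx big1 ?addr0 // => i ne.
by rewrite ffunE eq_sym (negPf ne).
Qed.

Lemma mem_prodvP (W : I -> {vspace vT}) (c : {ffun I -> vT}) :
  reflect (forall i, c i \in W i) (c \in prodv W).
Proof.
apply: (iffP memv_sumP) => [[x xW ->] j|cW].
  rewrite sum_ffunE; apply: memv_suml => i _.
  have /memv_imgP[y yW ->] := xW i isT; rewrite lfunE /= ffunE.
  by case: eqP => [->|_]; rewrite ?mem0v.
exists (fun i => single i (c i)); last exact: sum_single.
by move=> i _; apply/memv_imgP; exists (c i); rewrite ?lfunE.
Qed.

Lemma dim_prodv (W : I -> {vspace vT}) : \dim (prodv W) = (\sum_i \dim (W i))%N.
Proof.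
rewrite /prodv (directvP _) /=; last first.
  apply/directv_sum_independent => x xW x0 i _.
  have sx j : x j = single j (x j j).
    have /memv_imgP[y _ ->] := xW j isT.
    by rewrite lfunE /= /single ffunE eqxx.
  move/ffunP/(_ i): x0; rewrite sum_ffunE (bigD1 i) //= big1 => [|j ne].
    by rewrite addr0 ffunE => xii; rewrite sx xii linear0.
  by rewrite sx ffunE eq_sym (negPf ne).
apply: eq_bigr => i _; apply: (@dimv_linear_image _ _ (single i)) => [x _|x xW|].
- by move/ffunP/(_ i); rewrite !ffunE eqxx.
- by apply/memv_imgP; exists x; rewrite ?lfunE.
- by move=> _ /memv_imgP[x xW ->]; exists x; rewrite ?lfunE.
Qed.

End Product.
End LinearAlgebra.

(** * The Euler form and the standard complex *)

Section EulerForm.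
Variables (k : finFieldType) (m : nat) (Q : quiver m).
Local Notation kmod := (kmod k Q).
Implicit Types (M N P : kmod) (a b : Q) (i j : 'I_m).

Lemma mact_vertexM M i j :
  mact M (inl i) *m mact M (inl j) = if i == j then mact M (inl i) else 0.
Proof. by have [-> _ _] := prelP _ (mactP M). Qed.

Lemma mact_vertexK M i : mact M (inl i) *m mact M (inl i) = mact M (inl i).
Proof. by rewrite mact_vertexM eqxx. Qed.

Lemma sum_mact_vertex M : \sum_(i < m) mact M (inl i) = 1%:M.
Proof. by have [_ -> _] := prelP _ (mactP M). Qed.

Lemma mact_tgt M a : mact M (inl (tgt a)) *m mact M (inr a) = mact M (inr a).
Proof.
by have [_ _ /(_ a) <-] := prelP _ (mactP M); rewrite !mulmxA mact_vertexK.
Qed.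

Lemma mact_src M a : mact M (inr a) *m mact M (inl (src a)) = mact M (inr a).
Proof.
by have [_ _ /(_ a) <-] := prelP _ (mactP M); rewrite -!mulmxA mact_vertexK.
Qed.

Lemma mact_vertex_arrow M i a :
  mact M (inl i) *m mact M (inr a) = if i == tgt a then mact M (inr a) else 0.
Proof.
by rewrite -mact_tgt mulmxA mact_vertexM; case: eqP => [->|_]; rewrite ?mul0mx.
Qed.

Lemma mact_arrow_vertex M i a :
  mact M (inr a) *m mact M (inl i) = if src a == i then mact M (inr a) else 0.
Proof.
by rewrite -mact_src -mulmxA mact_vertexM; case: eqP => _; rewrite ?mulmx0.
Qed.

Lemma dimvE M i : dimv M i 0 = (\rank (mact M (inl i)))%:Z.
Proof. by rewrite mxE mul1mx. Qed.

(** The diagonal counts the degree 0 terms Hom(M_i, N_i) of the standard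
    complex of two modules M and N, and the arrows count its degree 1 terms
    Hom(M_(tgt a), N_(src a)); arrows act from the component at their target to
    the one at their source. *)
Definition euler_mx : 'M[int]_m :=
  \matrix_(i, j) ((i == j)%:R - #|[pred a : Q | (src a == j) && (tgt a == i)]|%:Z).

Lemma lform_eulerE (x y : 'cV[int]_m) :
  lform euler_mx x y
  = \sum_i x i 0 * y i 0 - \sum_(a : Q) x (tgt a) 0 * y (src a) 0.
Proof.
rewrite /lform mxE; under eq_bigr => j _ do rewrite mxE mulr_suml.
transitivity (\sum_j \sum_i (x i 0 * y j 0 * (i == j)%:R
   - \sum_(a : Q | (src a == j) && (tgt a == i)) x i 0 * y j 0)).
  apply: eq_bigr => j _; apply: eq_bigr => i _.
  rewrite !mxE sumr_const mulrBr mulrBl; congr (_ - _); first by rewrite mulrAC.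
  by rewrite -[RHS]mulr_natr natz mulrAC.
under eq_bigr => j _ do rewrite sumrB.
rewrite sumrB; congr (_ - _).
  apply: eq_bigr => j _; rewrite (bigD1 j) //= eqxx mulr1 big1 ?addr0 // => i.
  by move=> /negPf->; rewrite mulr0.
rewrite (partition_big (@src _ Q) predT) //=; apply: eq_bigr => j _.
rewrite (partition_big (@tgt _ Q) predT) //=; apply: eq_bigr => i _.
by apply: eq_bigr => a /andP[/eqP<- /eqP<-].
Qed.

(** Vanishing of Ext^1(M, N), read off the standard resolution: every family
    of linear maps indexed by the arrows is a coboundary. In this form it
    passes at once to submodules of M and to quotients of N. *)
Definition ext_vanish M N : Prop :=
  forall c : Q -> 'M[k]_(mdim M, mdim N),
    (forall a, mact M (inl (tgt a)) *m c a *m mact N (inl (src a)) = c a) ->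
  exists2 F : 'M[k]_(mdim M, mdim N),
    forall i, F *m mact N (inl i) = mact M (inl i) *m F
    & forall a, F *m mact N (inr a) - mact M (inr a) *m F = c a.

Section StandardComplex.
Variables M N : kmod.

(** Its kernel consists of the maps that factor through the projection of M to
    its component at i and the inclusion of the component of N at j. *)
Definition peirce_map i j (X : 'M[k]_(mdim M, mdim N)) :=
  mact M (inl i) *m X *m mact N (inl j) - X.

Fact peirce_linear i j : linear (peirce_map i j).
Proof.
move=> c X Y; rewrite /peirce_map mulmxDr mulmxDl -scalemxAr -scalemxAl scalerBr.
by rewrite opprD addrACA.
Qed.
HB.instance Definition _ i j :=
  GRing.isLinear.Build k 'M[k]_(mdim M, mdim N) 'M[k]_(mdim M, mdim N) *:%R
    (peirce_map i j) (peirce_linear i j).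

Definition peirce i j : {vspace 'M[k]_(mdim M, mdim N)} :=
  lker (linfun (peirce_map i j)).

Lemma mem_peirce i j X :
  (X \in peirce i j) = (mact M (inl i) *m X *m mact N (inl j) == X).
Proof. by rewrite memv_ker lfunE /= /peirce_map subr_eq0. Qed.

Lemma dim_peirce i j :
  \dim (peirce i j) = (\rank (mact M (inl i)) * \rank (mact N (inl j)))%N.
Proof. by apply: dimv_peirce (mem_peirce i j); rewrite mact_vertexK. Qed.

Definition std_diff (F : {ffun 'I_m -> 'M[k]_(mdim M, mdim N)}) :
    {ffun arrow Q -> 'M[k]_(mdim M, mdim N)} :=
  [ffun a => F (tgt a) *m mact N (inr a) - mact M (inr a) *m F (src a)].

Fact std_diff_linear : linear std_diff.
Proof.
move=> c F G; apply/ffunP => a; rewrite !ffunE mulmxDl mulmxDr.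
by rewrite -scalemxAl -scalemxAr scalerBr opprD addrACA.
Qed.
HB.instance Definition _ :=
  GRing.isLinear.Build k {ffun 'I_m -> 'M[k]_(mdim M, mdim N)}
    {ffun arrow Q -> 'M[k]_(mdim M, mdim N)} *:%R std_diff std_diff_linear.

Definition std0 := prodv (fun i => peirce i i).
Definition std1 := prodv (fun a : Q => peirce (tgt a) (src a)).

Definition components (F : 'M[k]_(mdim M, mdim N)) :
    {ffun 'I_m -> 'M[k]_(mdim M, mdim N)} :=
  [ffun i => mact M (inl i) *m F *m mact N (inl i)].

Fact components_linear : linear components.
Proof.
move=> c F G; apply/ffunP => a; rewrite !ffunE mulmxDr mulmxDl.
by rewrite -scalemxAr -scalemxAl.
Qed.
HB.instance Definition _ :=
  GRing.isLinear.Build k 'M[k]_(mdim M, mdim N)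
    {ffun 'I_m -> 'M[k]_(mdim M, mdim N)} *:%R components components_linear.

Lemma std0P (F : {ffun 'I_m -> 'M[k]_(mdim M, mdim N)}) :
  reflect (forall i, mact M (inl i) *m F i = F i /\ F i *m mact N (inl i) = F i)
          (F \in std0).
Proof.
apply: (iffP (mem_prodvP _ _)) => FV i; last first.
  by have [Fl Fr] := FV i; rewrite mem_peirce Fl Fr.
have := FV i; rewrite mem_peirce => /eqP <-.
split; first by rewrite !mulmxA mact_vertexK.
by rewrite -[LHS]mulmxA mact_vertexK.
Qed.

Lemma components_sum (F : {ffun 'I_m -> 'M[k]_(mdim M, mdim N)}) :
  F \in std0 -> components (\sum_i F i) = F.
Proof.
move=> /std0P FV; apply/ffunP => i; rewrite ffunE mulmx_sumr mulmx_suml.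
rewrite (bigD1 i) //= big1 => [|j ne]; first by have [Fl Fr] := FV i; rewrite Fl Fr addr0.
have [Fl _] := FV j.
by rewrite -Fl mulmxA mact_vertexM eq_sym (negPf ne) !mul0mx.
Qed.

Lemma sum_components F :
  (forall i, F *m mact N (inl i) = mact M (inl i) *m F) -> \sum_i components F i = F.
Proof.
move=> FV; under eq_bigr do rewrite ffunE -FV -mulmxA mact_vertexK.
by rewrite -mulmx_sumr sum_mact_vertex mulmx1.
Qed.

Lemma components_std0 F : components F \in std0.
Proof.
apply/std0P => i; rewrite ffunE !mulmxA mact_vertexK; split=> //.
by rewrite -[LHS]mulmxA mact_vertexK.
Qed.

Lemma std_diff_components F :
  (forall i, F *m mact N (inl i) = mact M (inl i) *m F) ->
  forall a, std_diff (components F) a = F *m mact N (inr a) - mact M (inr a) *m F.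
Proof.
move=> FV a; rewrite !ffunE -!FV -!mulmxA !mact_tgt mact_vertexK.
by rewrite FV [mact M _ *m (_ *m F)]mulmxA mact_src.
Qed.

(** A homomorphism is determined by its components at the vertices, and
    compatibility with the arrows is the vanishing of the differential. *)
Lemma dim_std0_ker : \dim (std0 :&: lker (linfun std_diff)) = dimHom M N.
Proof.
apply: (@dimv_linear_image _ _ _ components) => [F|F|F].
- rewrite memv_Hom => /is_homP hF F0; rewrite -[F]sum_components // F0.
  by rewrite big1 // => i _; rewrite ffunE.
- rewrite memv_Hom => /is_homP hF; rewrite memv_cap components_std0 memv_ker lfunE.
  by apply/eqP/ffunP => a; rewrite std_diff_components // hF subrr ffunE.
rewrite memv_cap memv_ker lfunE /= => /andP[FV /eqP dF].
exists (\sum_i F i); last by rewrite components_sum.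
have sV i : (\sum_i F i) *m mact N (inl i) = mact M (inl i) *m (\sum_i F i).
  have /std0P FP := FV; rewrite mulmx_suml mulmx_sumr; apply: eq_bigr => j _.
  have [Fl Fr] := FP j; rewrite -[in LHS]Fr -[in RHS]Fl -[LHS]mulmxA [RHS]mulmxA !mact_vertexM.
  by rewrite [j == i]eq_sym; case: eqP => [->|_]; rewrite ?mul0mx ?mulmx0 ?Fl ?Fr.
rewrite memv_Hom; apply/is_homP => -[i|a]; first exact: sV.
apply/eqP; rewrite -subr_eq0 -std_diff_components // components_sum // dF.
by rewrite ffunE.
Qed.

(** Rank-nullity for the differential, which is onto when extensions vanish. *)
Lemma dimHom_euler :
  ext_vanish M N -> (dimHom M N)%:Z = lform euler_mx (dimv M) (dimv N).
Proof.
move=> extMN; have := limg_ker_dim (linfun std_diff) std0.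
rewrite dim_std0_ker; have -> : (linfun std_diff @: std0)%VS = std1.
  apply/eqP; rewrite eqEsubv; apply/andP; split; apply/subvP => c.
    move=> /memv_imgP[F /std0P FV ->]; apply/mem_prodvP => a.
    rewrite mem_peirce lfunE /= ffunE mulmxBr mulmxBl !mulmxA mact_tgt.
    have [Fl _] := FV (tgt a); have [_ Fr] := FV (src a).
    by rewrite Fl -!mulmxA mact_src Fr.
  move=> /mem_prodvP cV; have [a|F FV dF] := extMN (fun a => c a).
    by have := cV a; rewrite mem_peirce => /eqP.
  apply/memv_imgP; exists (components F); first exact: components_std0.
  by rewrite lfunE; apply/ffunP => a; rewrite /= std_diff_components // dF.
rewrite !dim_prodv lform_eulerE => dimE.
transitivity ((\sum_i \dim (peirce i i))%:Z - (\sum_(a : Q) \dim (peirce (tgt a) (src a)))%:Z).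
  by rewrite -dimE PoszD addrK.
rewrite -!natz !natr_sum; congr (_ - _); apply: eq_bigr => i _;
  by rewrite dim_peirce !dimvE natrM !natz.
Qed.

End StandardComplex.
End EulerForm.

(** * Vanishing of extensions *)

Section Vanishing.
Variables (k : finFieldType) (m : nat) (Q : quiver m).
Local Notation kmod := (kmod k Q).
Implicit Types (M N P : kmod) (a b : Q) (i j : 'I_m).

(** Families of maps extend from P' to P along a linear retraction, and the
    solution found on P restricts to P'. *)
Lemma ext_vanish_sub P' P N (u : 'M[k]_(mdim P', mdim P)) :
  is_hom u -> row_free u -> ext_vanish P N -> ext_vanish P' N.
Proof.
move=> /is_homP hu free_u extPN c cV.
have [t ut] : exists t, u *m t = 1%:M by exists (pinvmx u); apply: mulmxVp.
have [a|F FV dF] := extPN (fun a => mact P (inl (tgt a)) *m t *m c a).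
  by rewrite !mulmxA mact_vertexK -(cV a) !mulmxA -[LHS]mulmxA mact_vertexK.
exists (u *m F) => [i|a]; first by rewrite -mulmxA FV !mulmxA hu.
rewrite [mact P' _ *m _]mulmxA -hu -!mulmxA -mulmxBr dF !mulmxA hu.
by rewrite -[_ *m u *m t]mulmxA ut mulmx1 -(cV a) !mulmxA mact_vertexK.
Qed.

(** Families of maps lift from N' to N along a linear section. *)
Lemma ext_vanish_quo M N N' (p : 'M[k]_(mdim N, mdim N')) :
  is_hom p -> row_full p -> ext_vanish M N -> ext_vanish M N'.
Proof.
move=> /is_homP hp full_p extMN c cV.
have [t tp] : exists t, t *m p = 1%:M by exists (pinvmx p); apply: mulVpmx.
have [a|F FV dF] := extMN (fun a => c a *m t *m mact N (inl (src a))).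
  by rewrite -!mulmxA mact_vertexK -(cV a) !mulmxA mact_vertexK.
exists (F *m p) => [i|a]; first by rewrite -mulmxA hp mulmxA FV mulmxA.
rewrite -[F *m _ *m _]mulmxA hp !mulmxA -mulmxBl dF -[LHS]mulmxA -hp mulmxA.
by rewrite -[c a *m t *m p]mulmxA tp mulmx1 -(cV a) -!mulmxA mact_vertexK.
Qed.

(** A family of maps c indexed by the arrows is the same thing as an extension
    of P by N, and a splitting of it is a map with coboundary c. *)
Lemma projective_ext_vanish P N : projective P -> ext_vanish P N.
Proof.
move=> projP c cV.
pose c' : {ffun pgen Q -> 'M[k]_(mdim P, mdim N)} :=
  [ffun x => if x is inr a then c a else 0].
have c'P : @ext_cocycle _ _ _ P N c'.
  apply/ext_cocycleP; split=> [i j||a].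
  - by rewrite !ffunE mul0mx mulmx0 addr0 if_same.
  - by rewrite big1 // => i _; rewrite ffunE.
  - by rewrite !ffunE mul0mx mulmx0 add0r addr0 cV.
pose L := Kmod c'P.
pose g : 'M[k]_(mdim L, mdim P) := col_mx 0 1%:M.
have hg : is_hom g.
  apply/is_homP => x.
  change (col_mx 0 1%:M *m mact P x
    = block_mx (mact N x) 0 (c' x) (mact P x) *m col_mx 0 1%:M).
  by rewrite mul_col_mx mul_block_col !(mul0mx, mulmx0, mulmx1, mul1mx, add0r).
have full_g : row_full g.
  apply/row_fullP; exists (row_mx 0 1%:M).
  by rewrite /g mul_row_col mul0mx mul1mx add0r.
have h1 : is_hom (1%:M : 'M[k]_(mdim P, mdim P)).
  by apply/is_homP => x; rewrite mul1mx mulmx1.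
have [s /is_homP hs sg] := projP L P g 1%:M hg full_g h1.
pose F : 'M[k]_(mdim P, mdim N) := lsubmx s.
have defs : s = row_mx F 1%:M.
  rewrite -[LHS](@hsubmxK _ _ (mdim N) (mdim P)) -/F; congr row_mx.
  move: sg; rewrite -[s in LHS](@hsubmxK _ _ (mdim N) (mdim P)) /g mul_row_col.
  by rewrite mulmx0 mulmx1 add0r.
have FE x : F *m mact N x + c' x = mact P x *m F.
  have := hs x; rewrite defs.
  change (row_mx F 1%:M *m block_mx (mact N x) 0 (c' x) (mact P x)
    = mact P x *m row_mx F 1%:M -> F *m mact N x + c' x = mact P x *m F).
  by rewrite mul_row_block mul_mx_row mul1mx => /eq_row_mx[].
exists (- F) => [i|a].
  by have := FE (inl i); rewrite ffunE addr0 mulNmx mulmxN => ->.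
by have := FE (inr a); rewrite ffunE mulNmx mulmxN => <-; rewrite opprK addKr.
Qed.

Hypothesis acyclicQ : acyclic Q.

(** A repeated vertex would cut out a closed walk. *)
Lemma acyclic_walk_uniq (i : 'I_m) (s : seq Q) :
  walk i s -> uniq (i :: [seq src a | a <- s]).
Proof.
elim: s i => // a s IHs i /andP[/eqP ta ws].
rewrite cons_uniq IHs // andbT; apply/negP => i_in.
pose r := index i [seq src b | b <- a :: s].
have r_lt : (r < size (a :: s))%N by rewrite -(size_map (@src _ Q)) index_mem.
have wr : walk i (take r.+1 (a :: s)).
  have : walk i (a :: s) by rewrite /= ta eqxx.
  by rewrite -{1}(cat_take_drop r.+1 (a :: s)) walk_cat => /andP[].
have /(acyclicQ wr) : wend i (take r.+1 (a :: s)) = i.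
  rewrite /wend map_take -nth_last size_takel ?size_map // nth_take //.
  exact: nth_index.
by [].
Qed.

Lemma acyclic_walk_size (i : 'I_m) (s : seq Q) : walk i s -> (size s < m)%N.
Proof.
move=> /acyclic_walk_uniq u; have := card_uniqP u.
rewrite /= size_map => <-; rewrite -[m in leqRHS]card_ord; exact: max_card.
Qed.

Definition mact_word M (s : seq Q) : 'M[k]_(mdim M) :=
  foldr (fun a X => mact M (inr a) *m X) 1%:M s.

Lemma mact_word_cat M s t : mact_word M (s ++ t) = mact_word M s *m mact_word M t.
Proof. by elim: s => [|a s IHs] /=; rewrite ?mul1mx // IHs mulmxA. Qed.

Lemma mact_word_walk M i s :
  ~~ walk i s -> mact M (inl i) *m mact_word M s = 0.
Proof.
elim: s i => // a s IHs i /=; rewrite mulmxA mact_vertex_arrow eq_sym.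
case: eqP => [_ /= /IHs ws|_ _]; last by rewrite mul0mx.
by rewrite -mact_src -mulmxA ws mulmx0.
Qed.

Lemma mact_word_nilpotent M s : size s = m -> mact_word M s = 0.
Proof.
move=> sm; rewrite -[LHS]mul1mx -sum_mact_vertex mulmx_suml big1 // => i _.
apply: mact_word_walk; apply/negP => /acyclic_walk_size.
by rewrite sm ltnn.
Qed.

(** In a space on which long words in the arrows act by zero, pushing a nonzero
    vector along arrows as long as the result is nonzero ends at a vector
    killed by all arrows. *)
Lemma exists_killed (T : zmodType) (op : Q -> T -> T) (S : T -> Prop) r v :
  (forall a w, S w -> S (op a w)) ->
  (forall s : seq Q, size s = r -> foldl (fun w a => op a w) v s = 0) ->
  S v -> v <> 0 -> exists2 w, S w & w <> 0 /\ forall a, op a w = 0.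
Proof.
move=> Sop; elim: r v => [|r IHr] v v_nil Sv v0; first by case: v0; apply: (v_nil [::]).
case: (pickP (fun a => op a v != 0)) => [a av|v1].
  apply: (IHr (op a v)) => [s sr||].
  - by apply: (v_nil (a :: s)); rewrite /= sr.
  - exact: Sop.
  - exact/eqP.
by exists v => //; split=> // a; apply/eqP; have := v1 a; case: eqP.
Qed.

(** The equations F N(a) = c a + M(a) F are solved by F = sum_a (c a + M(a) F) s a,
    and the iteration of the right-hand side is stationary because the
    products of arrows are nilpotent. *)
Lemma split_ext_vanish M N (s : Q -> 'M[k]_(mdim N)) :
  (forall a b, s a *m mact N (inr b) = if a == b then mact N (inl (src a)) else 0) ->
  ext_vanish M N.
Proof.
move=> sN c cV; pose s' a := s a *m mact N (inl (tgt a)).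
(* With s' in place of s, the fixed point commutes with the vertices. *)
have s'N a b : s' a *m mact N (inr b) = if a == b then mact N (inl (src a)) else 0.
  rewrite /s' -mulmxA mact_vertex_arrow; case: (tgt a =P tgt b) => [_|ne].
    exact: sN.
  by rewrite mulmx0; case: eqP ne => // ->.
pose Phi F := \sum_a (c a + mact M (inr a) *m F) *m s' a.
have PhiB F G : Phi F - Phi G = \sum_a mact M (inr a) *m (F - G) *m s' a.
  rewrite -sumrB; apply: eq_bigr => a _.
  by rewrite -mulmxBl opprD addrACA subrr add0r -mulmxBr.
(* After r steps the increment is a sum of terms starting with r arrows, so t
   and these arrows make a word of length m. *)
have iterP r t : (size t + r)%N = m ->
    mact_word M t *m (iter r.+1 Phi 0 - iter r Phi 0) = 0.
  elim: r t => [|r IHr] t tr.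
    by rewrite addn0 in tr; rewrite mact_word_nilpotent ?mul0mx.
  rewrite [iter r.+2 _ _]iterS [in X in _ - X]iterS PhiB mulmx_sumr big1 // => a _.
  rewrite !mulmxA.
  have -> : mact_word M t *m mact M (inr a) = mact_word M (rcons t a).
    by rewrite -cats1 mact_word_cat /= mulmx1.
  by rewrite IHr ?mul0mx // size_rcons addSnnS.
pose F := iter m Phi 0.
have defF : F = Phi F.
  apply/eqP; rewrite eq_sym -subr_eq0; apply/eqP.
  by have := iterP m [::] (add0n m); rewrite mul1mx.
have s'V a i : s' a *m mact N (inl i) = if i == tgt a then s' a else 0.
  rewrite /s' -mulmxA mact_vertexM [i == _]eq_sym.
  by case: eqP => // _; rewrite mulmx0.
have cFV a i : mact M (inl i) *m (c a + mact M (inr a) *m F)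
    = if i == tgt a then c a + mact M (inr a) *m F else 0.
  rewrite mulmxDr mulmxA mact_vertex_arrow -(cV a) !mulmxA mact_vertexM.
  by case: eqP => [->|_]; rewrite ?mul0mx ?addr0.
have FV i : F *m mact N (inl i) = mact M (inl i) *m F.
  rewrite defF /Phi mulmx_suml mulmx_sumr; apply: eq_bigr => a _.
  rewrite -[LHS]mulmxA s'V mulmxA cFV.
  by case: eqP => _; rewrite ?mulmx0 ?mul0mx.
exists F => // b; rewrite [F in F *m _]defF mulmx_suml (bigD1 b) //= big1 => [|a ne].
  rewrite addr0 -mulmxA s'N eqxx mulmxDl -mulmxA FV mulmxA mact_src addrK.
  by rewrite -[in RHS](cV b) -[in LHS](cV b) -!mulmxA mact_vertexK.
by rewrite -mulmxA s'N (negPf ne) mulmx0.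
Qed.

End Vanishing.

(** * Dimension vectors, tops and socles *)

Section RadicalSocle.
Variables (k : finFieldType) (m : nat) (Q : quiver m).
Local Notation kmod := (kmod k Q).
Implicit Types (M N P : kmod) (a b : Q) (i j : 'I_m).

Definition dimvr M r (U : 'M[k]_(r, mdim M)) : 'cV[int]_m :=
  \col_i (\rank (U *m mact M (inl i)))%:Z.

Lemma dimvr_eqmx M r s (U : 'M[k]_(r, mdim M)) (V : 'M[k]_(s, mdim M)) :
  (U :=: V)%MS -> dimvr U = dimvr V.
Proof. by move=> UV; apply/colP => i; rewrite !mxE (eqmxMr _ UV). Qed.

Lemma dimvr_row_full M r (U : 'M[k]_(r, mdim M)) : row_full U -> dimvr U = dimv M.
Proof.
move=> fullU; apply: dimvr_eqmx; apply/eqmxP.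
by rewrite submx1 sub1mx.
Qed.

Lemma dimvr_row_free K M (u : 'M[k]_(mdim K, mdim M)) :
  is_hom u -> row_free u -> dimvr u = dimv K.
Proof.
move=> /is_homP hu free_u; apply/colP => i.
by rewrite dimvE mxE hu mxrankMfree.
Qed.

(** Rank-nullity for the restriction of p to U, one vertex at a time. *)
Lemma dimvr_hom M N (p : 'M[k]_(mdim M, mdim N)) r (U : 'M[k]_(r, mdim M)) :
  is_hom p -> (forall i, stablemx U (mact M (inl i))) ->
  dimvr U = dimvr (U *m p) + dimvr (U :&: kermx p)%MS.
Proof.
move=> /is_homP hp stU; apply/colP => i; rewrite !mxE -PoszD; congr Posz.
rewrite -(mxrank_mul_ker _ p) -[U *m mact M _ *m p]mulmxA -hp mulmxA; congr (_ + _)%N.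
apply: eqmx_rank; apply/andP; split.
  apply/rV_subP => v; rewrite sub_capmx => /andP[/submxP[w ->] vp].
  have : (w *m (U *m mact M (inl i)) <= U :&: kermx p)%MS.
    rewrite sub_capmx vp andbT; apply: submx_trans (submxMl _ _) _; exact: stU.
  by move=> /(submxMr (mact M (inl i))); rewrite -!mulmxA mact_vertexK.
rewrite sub_capmx submxMr ?capmxSl //=.
by apply/sub_kermxP; rewrite -mulmxA -hp mulmxA (sub_kermxP (capmxSr _ _)) mul0mx.
Qed.

Lemma dimv_hom M N (p : 'M[k]_(mdim M, mdim N)) :
  is_hom p -> dimv M = dimvr p + dimvr (kermx p).
Proof.
move=> hp; rewrite -[LHS]/(dimvr (1%:M : 'M_(mdim M))) (dimvr_hom hp); last first.
  by move=> i; apply: submx1.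
rewrite mul1mx; congr (_ + _); apply: dimvr_eqmx.
by apply/eqmxP; rewrite capmxSr sub_capmx submx1 submx_refl.
Qed.

Lemma exact4_dimv K M N C (u : 'M[k]_(mdim K, mdim M))
    (f : 'M[k]_(mdim M, mdim N)) (p : 'M[k]_(mdim N, mdim C)) :
  exact4 u f p -> dimv M = dimvr f + dimv K /\ dimv N = dimv C + dimvr f.
Proof.
case=> -[hu hf hp] free_u ku kf full_p.
rewrite (dimv_hom hf) (dimv_hom hp) (dimvr_row_full full_p).
by rewrite -(dimvr_eqmx ku) (dimvr_row_free hu free_u) (dimvr_eqmx kf).
Qed.

Lemma exists_submodule M r (U : 'M[k]_(r, mdim M)) :
  (forall x, stablemx U (mact M x)) ->
  exists (K : kmod) (u : 'M[k]_(mdim K, mdim M)),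
    [/\ is_hom u, row_free u & (u :=: U)%MS].
Proof.
move=> stU; move: (eq_row_base U) (row_base_free U); move: (row_base U) => R RU freeR.
(* The generators act on the coordinates in the basis R; t is a partial
   inverse of R. *)
have [t Rt tR] : exists2 t, R *m t = 1%:M
    & forall x, R *m mact M x *m t *m R = R *m mact M x.
  exists (pinvmx R) => [|x]; first exact: mulmxVp.
  by apply: mulmxKpV; rewrite (eqmxMr _ RU) RU; apply: stU.
have relK : prel (fun x => R *m mact M x *m t).
  have [M1 M2 M3] := prelP _ (mactP M).
  have mulK x y : R *m mact M x *m t *m (R *m mact M y *m t) = R *m (mact M x *m mact M y) *m t.
    by rewrite !mulmxA tR.
  apply/prelP; split=> [i j||a].
  - by rewrite mulK M1; case: eqP => _ //; rewrite mulmx0 mul0mx.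
  - by rewrite -mulmx_suml -mulmx_sumr M2 mulmx1 Rt.
  - rewrite mulK mact_tgt !mulmxA tR -[R *m _ *m mact M (inl _)]mulmxA.
    by rewrite mact_src.
exists (Kmod relK), R; split=> //.
by apply/is_homP => x; rewrite -tR.
Qed.

Lemma is_hom_to_simpleP P j (phi : 'cV[k]_(mdim P)) :
  reflect (mact P (inl j) *m phi = phi /\ forall a, mact P (inr a) *m phi = 0)
          (@is_hom _ _ _ P (simple_mod k Q j) phi).
Proof.
apply: (iffP (@is_homP _ _ _ P (simple_mod k Q j) phi)) => [h|[h1 h2] [i|a]] /=.
- split=> [|a]; first by rewrite -(h (inl j)) /= eqxx mulmx1.
  by rewrite -(h (inr a)) /= mulmx0.
- rewrite -h1 mulmxA mact_vertexM mul_mx_scalar.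
  by case: eqP => [e|_]; rewrite ?e ?scale1r // scale0r mul0mx.
- by rewrite h2 mulmx0.
Qed.

Lemma is_hom_from_simpleP N j (v : 'rV[k]_(mdim N)) :
  reflect (v *m mact N (inl j) = v /\ forall a, v *m mact N (inr a) = 0)
          (@is_hom _ _ _ (simple_mod k Q j) N v).
Proof.
apply: (iffP (@is_homP _ _ _ (simple_mod k Q j) N v)) => [h|[h1 h2] [i|a]] /=.
- split=> [|a]; first by rewrite (h (inl j)) /= eqxx mul1mx.
  by rewrite (h (inr a)) /= mul0mx.
- rewrite -h1 -mulmxA mact_vertexM mul_scalar_mx eq_sym.
  by case: eqP => [e|_]; rewrite ?e ?scale1r // scale0r mulmx0.
- by rewrite h2 mul0mx.
Qed.

Lemma kermx_stable M N (F : 'M[k]_(mdim M, mdim N)) x :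
  is_hom F -> stablemx (kermx F) (mact M x).
Proof.
by move=> /is_homP hF; apply/sub_kermxP; rewrite -mulmxA -hF mulmxA mulmx_ker mul0mx.
Qed.

Lemma ker_submods M N (F : 'M[k]_(mdim M, mdim N)) :
  is_hom F -> <<kermx F>>%MS \in submods M.
Proof.
move=> hF; rewrite inE genmx_id eqxx /=; apply/forallP => x.
by rewrite (eqmxMr _ (genmxE _)) genmxE; apply: kermx_stable hF.
Qed.

Section Acyclic.
Hypothesis acyclicQ : acyclic Q.

Lemma exists_killed_row N r (U : 'M[k]_(r, mdim N)) :
  (forall x, stablemx U (mact N x)) -> U != 0 ->
  exists2 v : 'rV[k]_(mdim N), (v <= U)%MS & v != 0 /\
    exists j, @is_hom _ _ _ (simple_mod k Q j) N v.
Proof.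
move=> stU /rowV0Pn[u0 u0U u0_neq0].
have opU a (w : 'rV_(mdim N)) : (w <= U)%MS -> (w *m mact N (inr a) <= U)%MS.
  by move=> wU; apply: submx_trans (submxMr _ wU) (stU _).
have foldE s (w : 'rV_(mdim N)) :
    foldl (fun w a => w *m mact N (inr a)) w s = w *m mact_word N s.
  by elim: s w => [|a s IHs] w /=; rewrite ?mulmx1 // IHs mulmxA.
have [|v vU [v0 va]] := @exists_killed _ Q _ (fun a w => w *m mact N (inr a))
    (fun w => w <= U)%MS m u0 opU _ u0U (elimN eqP u0_neq0).
  by move=> s sm; rewrite foldE mact_word_nilpotent ?mulmx0.
case: (pickP (fun j => v *m mact N (inl j) != 0)) => [j vj|vj].
  exists (v *m mact N (inl j)); first exact: submx_trans (submxMr _ vU) (stU _).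
  split=> //; exists j; apply/is_hom_from_simpleP.
  rewrite -mulmxA mact_vertexK; split=> // a.
  by rewrite -mulmxA mact_vertex_arrow; case: eqP => _; rewrite ?va ?mulmx0.
case: v0; rewrite -[v]mulmx1 -(sum_mact_vertex N) mulmx_sumr big1 // => j _.
by have := vj j; case: eqP.
Qed.

(** The dual form of the preceding lemma, with linear forms on P vanishing on U
    in place of vectors of U. *)
Lemma exists_killed_col P r (U : 'M[k]_(r, mdim P)) :
  (forall x, stablemx U (mact P x)) -> ~~ row_full U ->
  exists2 phi : 'cV[k]_(mdim P), U *m phi = 0 & phi != 0 /\
    exists j, @is_hom _ _ _ P (simple_mod k Q j) phi.
Proof.
move=> stU nfullU.
have opU x (w : 'cV_(mdim P)) : U *m w = 0 -> U *m (mact P x *m w) = 0.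
  by move=> wU; have /submxP[z zE] := stU x; rewrite mulmxA zE -mulmxA wU mulmx0.
have foldE s (w : 'cV_(mdim P)) :
    foldl (fun w a => mact P (inr a) *m w) w s = mact_word P (rev s) *m w.
  elim: s w => [|a s IHs] w /=; first by rewrite mul1mx.
  by rewrite IHs rev_cons -cats1 mact_word_cat /= mulmx1 mulmxA.
have [phi0 phi0U phi0_neq0] : exists2 phi : 'cV_(mdim P), U *m phi = 0 & phi != 0.
  have : (cokermx U)^T != 0.
    apply: contra nfullU; rewrite trmx_eq0 => /eqP c0.
    by rewrite -sub1mx submxE c0 mulmx0.
  move=> /rowV0Pn[v /submxP[w vE] v0]; exists v^T; last by rewrite trmx_eq0.
  by rewrite vE trmx_mul trmxK mulmxA mulmx_coker mul0mx.
have [|phi phiU [phi1 phia]] := @exists_killed _ Q _ (fun a w => mact P (inr a) *m w)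
    (fun w => U *m w = 0) m phi0 (fun a => @opU (inr a)) _ phi0U (elimN eqP phi0_neq0).
  by move=> s sm; rewrite foldE mact_word_nilpotent ?mul0mx ?size_rev.
case: (pickP (fun j => mact P (inl j) *m phi != 0)) => [j phij|phij].
  exists (mact P (inl j) *m phi); first exact: opU.
  split=> //; exists j; apply/is_hom_to_simpleP.
  rewrite mulmxA mact_vertexK; split=> // a.
  by rewrite mulmxA mact_arrow_vertex; case: eqP => _; rewrite ?phia ?mul0mx.
case: phi1; rewrite -[phi]mul1mx -(sum_mact_vertex P) mulmx_suml big1 // => j _.
by have := phij j; case: eqP.
Qed.

(** Every maximal submodule contains the images of the arrows: otherwise it is
    contained in the kernel of a nonzero map to a simple module, which contains
    them, and maximality gives equality. *)
Lemma arrow_sub_maximal P a (U : 'M[k]_(mdim P)) :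
  maximal_submod U -> (mact P (inr a) <= U)%MS.
Proof.
rewrite /maximal_submod inE => /and3P[/andP[_ /forallP stU] ltU /forallP maxU].
have nfullU : ~~ row_full U.
  by move: ltU; rewrite ltmxE sub1mx => /andP[].
have [phi phiU [phi0 [j hphi]]] := exists_killed_col stU nfullU.
have /is_hom_to_simpleP[_ phia] := hphi.
apply: contraT => naU; have := maxU <<kermx phi>>%MS.
rewrite (ker_submods hphi) /= sub1mx ltmxE !genmxE (introT sub_kermxP phiU) /=.
have -> /= : ~~ (kermx phi <= U)%MS.
  by apply: contra naU; apply: submx_trans; apply/sub_kermxP.
rewrite -sub1mx genmxE => /sub_kermxP; rewrite mul1mx => /eqP.
by rewrite (negPf phi0).
Qed.

(** The kernel has codimension one. *)
Lemma ker_to_simple_maximal P j (phi : 'cV[k]_(mdim P)) :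
  @is_hom _ _ _ P (simple_mod k Q j) phi -> phi != 0 ->
  @maximal_submod _ _ _ P <<kermx phi>>%MS.
Proof.
move=> hphi phi0; have rk1 : \rank phi = 1%N.
  by apply/eqP; rewrite eqn_leq rank_leq_col lt0n mxrank_eq0.
rewrite /maximal_submod (ker_submods hphi) /=; apply/andP; split.
  rewrite ltmxErank submx1 mxrank1 genmxE mxrank_ker rk1 /= ltn_subrL /=.
  by rewrite -rk1 rank_leq_row.
apply/forallP => V; apply/implyP => _; apply/implyP.
rewrite ltmxErank !genmxE mxrank_ker rk1 sub1mx => /andP[_ ltV].
rewrite /row_full eqn_leq rank_leq_col /=.
by move: ltV; rewrite ltn_subLR ?add1n // -rk1 rank_leq_row.
Qed.

Lemma hom_to_simple_rad P j (phi : 'cV[k]_(mdim P)) :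
  @is_hom _ _ _ P (simple_mod k Q j) phi
  = (rad P *m phi == 0) && (mact P (inl j) *m phi == phi).
Proof.
apply/is_hom_to_simpleP/andP => [[phij phia]|[/eqP radphi /eqP phij]]; last first.
  split=> // a; have /submxP[z ->] : (mact P (inr a) <= rad P)%MS.
    by apply/sub_bigcapmxP => U; apply: arrow_sub_maximal.
  by rewrite -mulmxA radphi mulmx0.
rewrite phij; split=> //; have [->|phi0] := eqVneq phi 0; first by rewrite mulmx0.
have hphi : @is_hom _ _ _ P (simple_mod k Q j) phi by apply/is_hom_to_simpleP.
apply/eqP/sub_kermxP; rewrite -(genmxE (kermx phi)).
exact: bigcapmx_inf (ker_to_simple_maximal hphi phi0) (submx_refl _).
Qed.

Lemma dimHom_to_simple P j :
  (dimHom P (simple_mod k Q j))%:Z = dimv_top P j 0.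
Proof.
(* J is the common kernel of the maps from P to the simple module at j. *)
pose E := mact P (inl j); pose J := (rad P + (1%:M - E))%MS.
have homJ (phi : 'cV[k]_(mdim P)) :
    (phi \in Hom P (simple_mod k Q j)) = (phi^T <= kermx J^T)%MS.
  rewrite (@memv_Hom _ _ _ P (simple_mod k Q j)) hom_to_simple_rad sub_kermx -trmx_mul trmx_eq0.
  rewrite -[J *m phi == 0]sub_kermx addsmx_sub !sub_kermx mulmxBl mul1mx.
  by rewrite subr_eq0 [phi == _]eq_sym.
have kerE : (kermx E <= J)%MS.
  apply: submx_trans (addsmxSr _ _); apply/submxP; exists (kermx E).
  by rewrite mulmxBr mulmx1 mulmx_ker subr0.
have rkJ : (\rank J = \rank (rad P *m E) + (mdim P - \rank E))%N.
  rewrite -(mxrank_mul_ker J E) -mxrank_ker; congr (_ + _)%N; apply: eqmx_rank.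
    apply/eqmxP; apply: eqmx_trans (addsmxMr _ _ _) _.
    rewrite mulmxBl mul1mx mact_vertexK subrr; exact: addsmx0.
  by rewrite capmxSr sub_capmx kerE submx_refl.
have -> : dimHom P (simple_mod k Q j) = (mdim P - \rank J)%N.
  by rewrite /dimHom (dimv_colspace homJ) mxrank_ker mxrank_tr.
rewrite !mxE mul1mx rkJ -/E [(_ + (_ - _))%N]addnC subnDA subKn ?rank_leq_row //.
by rewrite subzn // mxrankM_maxr.
Qed.

(** A simple submodule contains a nonzero vector killed by the arrows, which
    spans it. *)
Lemma simple_submod_arrow N a (U : 'M[k]_(mdim N)) :
  simple_submod U -> U *m mact N (inr a) = 0.
Proof.
rewrite /simple_submod inE => /and3P[/andP[_ /forallP stU] U0 /forallP minU].
have [v vU [v0 [j hv]]] := exists_killed_row stU U0.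
have /is_hom_from_simpleP[vj va] := hv.
have Vst : <<v>>%MS \in submods N.
  rewrite inE genmx_id eqxx; apply/forallP => x; rewrite (eqmxMr _ (genmxE _)) genmxE.
  by move/is_homP: hv => ->; apply: submxMl.
have := minU <<v>>%MS; rewrite Vst /= ltmxE !genmxE vU /=.
rewrite -mxrank_eq0 genmxE mxrank_eq0 (negPf v0) implybF negbK.
by move=> /submxP[z ->]; rewrite -mulmxA va mulmx0.
Qed.

Lemma from_simple_simple N j (v : 'rV[k]_(mdim N)) :
  @is_hom _ _ _ (simple_mod k Q j) N v -> v != 0 ->
  @simple_submod _ _ _ N <<v>>%MS.
Proof.
move=> hv v0; rewrite /simple_submod inE genmx_id eqxx /=.
rewrite -mxrank_eq0 genmxE mxrank_eq0 v0 /=; apply/andP; split.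
  apply/forallP => x; rewrite (eqmxMr _ (genmxE _)) genmxE.
  by move/is_homP: hv => ->; apply: submxMl.
apply/forallP => V; apply/implyP => _; apply/implyP.
rewrite ltmxErank !genmxE => /andP[_ ltV]; rewrite -mxrank_eq0 -leqn0 -ltnS.
exact: leq_trans ltV (rank_leq_row _).
Qed.

Lemma dimHom_from_simple N j :
  (dimHom (simple_mod k Q j) N)%:Z = dimv_sub (soc N) j 0.
Proof.
rewrite mxE; congr Posz; apply: dimv_rowspace => v.
rewrite (@memv_Hom _ _ _ (simple_mod k Q j) N).
have [->|v0] := eqVneq v 0.
  by rewrite sub0mx; apply/is_hom_from_simpleP; split=> [|a]; rewrite mul0mx.
apply/idP/idP => [hv|/submxP[w ->]].
  have /is_hom_from_simpleP[<- _] := hv; apply: submxMr.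
  rewrite -(genmxE v); exact: sumsmx_sup (from_simple_simple hv v0) (submx_refl _).
have socM x : (soc N *m mact N x <= soc N)%MS.
  rewrite sumsmxMr; apply/sumsmx_subP => U simU.
  apply: submx_trans (sumsmx_sup U simU (submx_refl _)).
  by case/and3P: simU; rewrite inE => /andP[_ /forallP/(_ x)].
have soc0 a : soc N *m mact N (inr a) = 0.
  apply/eqP; rewrite -sub_kermx; apply/sumsmx_subP => U simU.
  by rewrite sub_kermx simple_submod_arrow.
apply/is_hom_from_simpleP; rewrite -!mulmxA mact_vertexK; split=> // a.
have /submxP[z zE] := socM (inl j).
by rewrite -!mulmxA [soc N *m _]mulmxA zE -[z *m _ *m _]mulmxA soc0 !mulmx0.
Qed.

Lemma top_iso_soc_dimv P I : top_iso_soc P I -> dimv_top P = dimv_sub (soc I).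
Proof.
case=> h hh [kerh imh].
rewrite /dimv_top (dimv_hom hh) (dimvr_eqmx kerh) (dimvr_eqmx imh).
exact: addrK.
Qed.

End Acyclic.
End RadicalSocle.

(** * First arrows of paths *)

Section Nakayama.
Variables (k : finFieldType) (m : nat) (Q : quiver m).
Hypothesis acyclicQ : acyclic Q.
Local Notation kmod := (kmod k Q).
Local Notation A := (reg_mod k Q).
Local Notation q := #|qpath Q|.
Local Notation lmul := (lmul k).
Implicit Types (M N P : kmod) (a b : Q) (i j : 'I_m).
Arguments pword : simpl never.

Lemma path_word i (s : seq Q) : walk i s -> exists p, pword p = (i, s).
Proof. by move=> ws; apply: pwordE => //; apply: ltnW; apply: acyclic_walk_size ws. Qed.

(** The transpose of left multiplication by a in the basis of paths: it removes
    the leading arrow of a path when this is a, and kills all other paths. *)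
Definition strip a : 'M[k]_q := (lmul (inr a))^T.

Lemma lmul_strip a b :
  lmul (inr b) *m strip a = if a == b then lmul (inl (src a)) else 0.
Proof.
apply/matrixP => p r; rewrite mxE; under eq_bigr do rewrite !mxE.
rewrite sum_nat_ind; last by move=> ? ?; apply: is_cat_inj.
case: (a =P b) => [<-|ne]; last first.
  rewrite mxE; case: existsP => // -[s /andP[/and3P[_ _ /eqP s1] /and3P[_ _ /eqP]]].
  by rewrite s1 => -[ab _]; case: ne.
rewrite lmulv !mxE; case: (p =P r) => [<-|ne]; last first.
  case: existsP => // -[s /andP[/and3P[_ /eqP p1 /eqP s2] /and3P[_ /eqP r1]]].
  rewrite s2 => /eqP [pr]; case: ne; apply: pword_eq => //.
  by rewrite -p1 -r1.
rewrite mulr1n; congr (nat_of_bool _)%:R; apply/existsP/eqP => [[s]|pa].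
  by rewrite andbb => /and3P[_ /eqP <- _].
have [|s sE] := @path_word (tgt a) (a :: (pword p).2).
  by rewrite /= eqxx -pa pword_walk.
by exists s; rewrite andbb /is_cat sE pa /wend /= !eqxx.
Qed.

Lemma strip_src a : strip a *m lmul (inl (src a)) = strip a.
Proof.
have [h1 _ h3] := lmul_prel k Q.
have symE i : (lmul (inl i))^T = lmul (inl i) by rewrite lmulv tr_diag_mx.
rewrite /strip; have <- : lmul (inl (src a)) *m lmul (inr a) = lmul (inr a).
  by rewrite -[in LHS]h3 !mulmxA h1 eqxx h3.
by rewrite trmx_mul symE -mulmxA h1 eqxx.
Qed.

Definition top_coef j : 'cV[k]_q := \col_p (pword p == (j, [::]))%:R.

(** Removing the leading arrow and putting it back is the identity on all paths
    but the trivial ones. *)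
Lemma sum_strip_lmul :
  \sum_a strip a *m lmul (inr a) = 1%:M - \sum_j top_coef j *m (top_coef j)^T.
Proof.
apply/matrixP => p r; rewrite !mxE !summxE.
under eq_bigr => a _.
  rewrite mxE; under eq_bigr do rewrite !mxE.
  over.
under [in RHS]eq_bigr => j _ do rewrite mxE big_ord1 !mxE.
case def_p: (pword p) => [i [|a s]].
  rewrite big1 => [|a _]; last first.
    by rewrite big1 // => t _; rewrite /is_cat; case: and3P => [[_ _ /eqP]|_]; rewrite ?mul0r.
  rewrite (bigD1 i) //= eqxx mul1r big1 => [|j ne]; last first.
    by rewrite xpair_eqE eq_sym (negPf ne) mul0r.
  by rewrite addr0 -def_p (inj_eq (@pword_inj _ Q)) eq_sym subrr.
rewrite [X in _ = _ - X]big1 ?subr0 => [|j _]; last first.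
  by rewrite xpair_eqE andbF mul0r.
have wp := pword_walk p; rewrite def_p /= in wp; have /andP[/eqP ta ws] := wp.
have [t tE] := path_word ws.
rewrite (bigD1 a) //= [X in _ + X]big1 => [|b ne]; last first.
  rewrite big1 // => t' _; rewrite /is_cat /=.
  by rewrite eqseq_cons [a == b]eq_sym (negPf ne) !andbF mul0r.
rewrite addr0 (bigD1 t) //= [X in _ + X]big1 => [|t' ne]; last first.
  rewrite /is_cat; case: and3P => [[_ /eqP t1 /eqP[t2]]|_]; rewrite ?mul0r //.
  by case/eqP: ne; apply: pword_inj; rewrite tE [LHS]surjective_pairing -t1 t2.
rewrite addr0 /is_cat tE /wend /= ta !eqxx mul1r -(inj_eq (@pword_inj _ Q)).
by rewrite def_p [pword r]surjective_pairing xpair_eqE eq_sym [_ == (_ r).2]eq_sym.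
Qed.

Lemma strip_lmul (r : nat) (alpha : 'M[k]_(r, q)) :
  (forall j, alpha *m top_coef j = 0) ->
  alpha = \sum_a alpha *m strip a *m lmul (inr a).
Proof.
move=> alpha0; under eq_bigr do rewrite -mulmxA.
rewrite -mulmx_sumr sum_strip_lmul mulmxBr mulmx1 mulmx_sumr big1 ?subr0 // => j _.
by rewrite mulmxA alpha0 mul0mx.
Qed.

Lemma top_coef_hom j : @is_hom _ _ _ A (simple_mod k Q j) (top_coef j).
Proof.
apply/is_hom_to_simpleP; split=> [|a].
  change (rmul k (inl j) *m top_coef j = top_coef j).
  rewrite rmulv; apply/colP => p; rewrite mul_diag_mx !mxE.
  by case: (pword p =P _) => [->|_]; rewrite ?mulr0 // /wend eqxx mulr1.
change (rmul k (inr a) *m top_coef j = 0).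
apply/colP => p; rewrite !mxE big1 // => r _; rewrite !mxE /is_cat.
case: (pword r =P _) => [->|_]; last by rewrite mulr0.
case: and3P => [[_ _ /eqP/(congr1 size)]|_]; rewrite ?mul0r //.
by rewrite size_cat addn1.
Qed.

Lemma lmul_vertex_top_coef i j :
  lmul (inl i) *m top_coef j = if i == j then top_coef j else 0.
Proof.
rewrite lmulv; apply/colP => p; rewrite mul_diag_mx !mxE.
case: (pword p =P _) => [pE|/eqP/negPf ne]; rewrite [i == j]eq_sym.
  by rewrite pE mulr1 /=; case: eqP => _; rewrite !mxE ?pE ?eqxx.
by rewrite mulr0; case: eqP; rewrite !mxE ?ne.
Qed.

Lemma lmul_arrow_top_coef a j : lmul (inr a) *m top_coef j = 0.
Proof.
apply/colP => p; rewrite !mxE big1 // => r _; rewrite !mxE.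
case: (pword r =P _) => [rE|_]; last by rewrite mulr0.
by rewrite /is_cat rE; case: and3P => [[_ _ /eqP]|_]; rewrite ?mul0r.
Qed.

End Nakayama.

(** * Injectivity and socle of the Nakayama module *)

Lemma mulmx_col_ext (k : fieldType) r n (X Y : 'M[k]_(r, n)) :
  (forall y : 'cV_n, X *m y = Y *m y) -> X = Y.
Proof.
move=> XY; apply: trmx_inj; apply/row_matrixP => i.
by rewrite !rowE -[delta_mx 0 i]trmxK -!trmx_mul XY.
Qed.

Lemma linear_col_matrix (k : fieldType) n p (g : 'cV[k]_n -> 'cV[k]_p) :
  linear g -> exists S : 'M[k]_(p, n), forall y, S *m y = g y.
Proof.
move=> lin_g; pose gt (v : 'rV[k]_n) : 'rV[k]_p := (g v^T)^T.
have lin_gt : linear gt by move=> c u v; rewrite /gt !linearP /= lin_g linearP.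
pose G : {linear 'rV[k]_n -> 'rV[k]_p} :=
  HB.pack gt (GRing.isLinear.Build k _ _ *:%R gt lin_gt).
exists (lin1_mx G)^T => y; apply: trmx_inj.
by rewrite trmx_mul trmxK mul_rV_lin1 /= /gt trmxK.
Qed.

Section NakayamaCoordinates.
Variables (k : finFieldType) (m : nat) (Q : quiver m).
Hypothesis acyclicQ : acyclic Q.
Local Notation kmod := (kmod k Q).
Local Notation A := (reg_mod k Q).
Local Notation q := #|qpath Q|.
Local Notation lmul := (lmul k).
Implicit Types (a b : Q) (i j : 'I_m).
Variable P : kmod.
Local Notation h := (dimHom P A).
Local Notation basis := (vbasis (Hom P A)).
Local Notation N := (nu_act P).

(** Column vectors are coordinates on Hom(P, kQ), on which the matrices of nu P
    act from the left as left multiplications of paths; row vectors are linear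
    forms on it, that is, elements of nu P. *)
Definition hom_of (y : 'cV[k]_h) : 'M[k]_(mdim P, q) := \sum_l y l 0 *: basis`_l.

Lemma hom_of_hom y : hom_of y \in Hom P A.
Proof.
apply: memv_suml => l _; apply/memvZ/vbasis_mem/mem_nth.
by rewrite size_tuple.
Qed.

Lemma hom_of_surj alpha : alpha \in Hom P A -> exists y, hom_of y = alpha.
Proof.
move=> /coord_vbasis alphaE; exists (\col_l coord basis l alpha).
by rewrite [RHS]alphaE; apply: eq_bigr => l _; rewrite mxE.
Qed.

Lemma hom_of_inj : injective hom_of.
Proof.
move=> y z yz; apply/colP => l; have := congr1 (coord basis l) yz.
by rewrite !coord_sum_free ?(basis_free (vbasisP _)).
Qed.

Lemma hom_of_sum (I : finType) (y : I -> 'cV[k]_h) :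
  hom_of (\sum_i y i) = \sum_i hom_of (y i).
Proof.
rewrite exchange_big; apply: eq_bigr => l _ /=.
by rewrite summxE scaler_suml.
Qed.

Lemma hom_of_nu x y : hom_of (N x *m y) = hom_of y *m lmul x.
Proof.
rewrite /hom_of mulmx_suml.
transitivity (\sum_j y j 0 *: \sum_l coord basis l (basis`_j *m lmul x) *: basis`_l).
  under [RHS]eq_bigr do rewrite scaler_sumr.
  rewrite [RHS]exchange_big; apply: eq_bigr => l _ /=.
  rewrite mxE scaler_suml; apply: eq_bigr => j _.
  by rewrite mxE scalerA mulrC.
apply: eq_bigr => j _; rewrite -scalemxAl; congr (_ *: _).
by apply/esym/coord_vbasis/Hom_lmul/vbasis_mem/mem_nth; rewrite size_tuple.
Qed.

Definition nu_sum (c : {ffun arrow Q -> 'cV[k]_h}) : 'cV[k]_h := \sum_a N (inr a) *m c a.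

Fact nu_sum_linear : linear nu_sum.
Proof.
move=> d c c'; rewrite /nu_sum scaler_sumr -big_split /=; apply: eq_bigr => a _.
by rewrite !ffunE mulmxDr scalemxAr.
Qed.
HB.instance Definition _ :=
  GRing.isLinear.Build k {ffun arrow Q -> 'cV[k]_h} 'cV[k]_h *:%R nu_sum nu_sum_linear.

Lemma nu_sum_eq0 c a : nu_sum c = 0 -> N (inl (src a)) *m c a = 0.
Proof.
move=> c0; have := congr1 (fun y => hom_of y *m strip k a) c0.
have hom0 : hom_of 0 = 0 by rewrite /hom_of big1 // => l _; rewrite mxE scale0r.
rewrite hom0 mul0mx hom_of_sum mulmx_suml (bigD1 a) //= big1 => [|b ne].
  rewrite addr0 hom_of_nu -mulmxA lmul_strip // eqxx -hom_of_nu -hom0.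
  exact: hom_of_inj.
by rewrite hom_of_nu -mulmxA lmul_strip // eq_sym (negPf ne) mulmx0.
Qed.

(** Up to the components that they kill, left multiplications by distinct arrows
    are jointly injective on Hom(P, kQ), because the first arrow of a path can
    be read off and removed. Dually, the arrows act jointly surjectively on
    nu P. *)
Lemma nu_split : exists s : Q -> 'M[k]_h, forall a b,
  s a *m mact (nu P) (inr b) = if a == b then mact (nu P) (inl (src a)) else 0.
Proof.
(* A section of nu_sum need not be its left inverse, but it is one up to the
   kernel of nu_sum, and nu_sum_eq0 makes the components at the sources exact. *)
pose g := ((linfun nu_sum)^-1)%VF.
have [S SE] : exists S : Q -> 'M[k]_h, forall a y, S a *m y = N (inl (src a)) *m g y a.
  have SE a : exists S : 'M[k]_h, forall y, S *m y = N (inl (src a)) *m g y a.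
    apply: linear_col_matrix => c y z.
    by rewrite linearP !ffunE mulmxDr scalemxAr.
  have /fin_all_exists[S SP] := SE.
  by exists S.
exists S => a b; apply: mulmx_col_ext => y; rewrite -mulmxA SE.
have : nu_sum (g (nu_sum (single b y)) - single b y) = 0.
  rewrite linearB /= -[X in X - _ = _]lfunE /= limg_lfunVK ?subrr //.
  by rewrite -[nu_sum _]lfunE memv_img ?memvf.
move=> /nu_sum_eq0 - /(_ a).
have -> : nu_sum (single b y) = N (inr b) *m y.
  rewrite /nu_sum (bigD1 b) //= ffunE eqxx big1 ?addr0 // => b' ne.
  by rewrite ffunE (negPf ne) mulmx0.
rewrite !ffunE mulmxBr => /eqP; rewrite subr_eq0 => /eqP ->.
by case: eqP => _; rewrite ?mulmx0 ?mul0mx.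
Qed.

(** A map alpha without constant terms is the sum of the products of the arrows
    b with alpha composed with strip b. Composing with strip a the equations
    that make alpha a homomorphism isolates the term of a. *)
Lemma strip_hom a (alpha : 'M[k]_(mdim P, q)) :
  alpha \in Hom P A -> (forall j, alpha *m top_coef k Q j = 0) ->
  alpha *m strip k a \in Hom P A.
Proof.
rewrite !(@memv_Hom _ _ _ P A) => /(@is_homP _ _ _ P A) halpha /(strip_lmul acyclicQ) alphaE.
apply/(@is_homP _ _ _ P A) => x.
change (alpha *m strip k a *m rmul k x = mact P x *m (alpha *m strip k a)).
rewrite mulmxA -halpha; change (mact A x) with (rmul k x).
rewrite {2}alphaE !mulmx_suml (bigD1 a) //= big1 => [|b ne].
  rewrite addr0 -[_ *m lmul _ *m _]mulmxA lmul_rmul mulmxA -[RHS]mulmxA.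
  rewrite lmul_strip // eqxx -[RHS]mulmxA -lmul_rmul mulmxA.
  by rewrite -[alpha *m strip k a *m lmul _]mulmxA strip_src.
rewrite -[_ *m lmul _ *m _]mulmxA lmul_rmul mulmxA -[LHS]mulmxA.
by rewrite lmul_strip // eq_sym (negPf ne) mulmx0.
Qed.

(** The maps alpha : P -> kQ whose coefficient at the trivial path of j vanishes
    are, at j, sums of products of arrows with maps, so that the vectors of nu P
    at j killed by the arrows are the linear forms on Hom(P, kQ) depending on
    this coefficient only. As P is projective, every map from P to the simple
    module at j is such a coefficient. *)
Lemma dimHom_nu_simple j : projective P ->
  dimHom (simple_mod k Q j) (nu P) = dimHom P (simple_mod k Q j).
Proof.
move=> projP; pose T := top_coef k Q j.
(* Psi is the matrix of alpha |-> alpha *m T: its row space is compared with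
   the first Hom space and its column space with the second. *)
pose Psi : 'M[k]_(mdim P, h) := \matrix_(i, l) (basis`_l *m T) i 0.
have PsiE y : Psi *m y = hom_of y *m T.
  rewrite mulmx_suml; apply/colP => i; rewrite mxE summxE; apply: eq_bigr => l _.
  by rewrite mxE -scalemxAl [RHS]mxE mulrC.
have -> : dimHom (simple_mod k Q j) (nu P) = \rank Psi.
  apply: dimv_rowspace => F; rewrite (@memv_Hom _ _ _ (simple_mod k Q j) (nu P)).
  apply/(@is_hom_from_simpleP _ _ _ (nu P) j F)/idP => [[Fj Fa]|/submxP[G ->]].
    rewrite submxE; apply/eqP/mulmx_col_ext => z; rewrite mul0mx -mulmxA.
    set y := cokermx Psi *m z.
    have y0 : hom_of y *m T = 0 by rewrite -PsiE mulmxA mulmx_coker mul0mx.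
    pose alpha := hom_of (N (inl j) *m y).
    have alphaT l : alpha *m top_coef k Q l = 0.
      rewrite /alpha hom_of_nu -mulmxA lmul_vertex_top_coef.
      by case: eqP => [<-|_]; rewrite ?mulmx0.
    have hom_strip a := strip_hom a (hom_of_hom _) alphaT.
    have z_ex a : exists z', hom_of z' = alpha *m strip k a by apply: hom_of_surj.
    have [z' z'E] := fin_all_exists z_ex.
    have yE : N (inl j) *m y = \sum_a N (inr a) *m z' a.
      apply: hom_of_inj; rewrite hom_of_sum -/alpha [LHS](strip_lmul acyclicQ alphaT).
      by apply: eq_bigr => a _; rewrite hom_of_nu z'E.
    rewrite -Fj -mulmxA.
    change (F *m (N (inl j) *m y) = 0).
    rewrite yE mulmx_sumr big1 // => a _; rewrite mulmxA.
    by rewrite -[F *m _]/(F *m mact (nu P) (inr a)) Fa mul0mx.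
  split=> [|a]; rewrite -mulmxA.
    congr (_ *m _); apply: mulmx_col_ext => y; rewrite -mulmxA PsiE hom_of_nu.
    by rewrite -mulmxA lmul_vertex_top_coef eqxx -PsiE.
  rewrite -[RHS](mulmx0 _ G); congr (_ *m _); apply: mulmx_col_ext => y.
  by rewrite -mulmxA PsiE hom_of_nu -mulmxA lmul_arrow_top_coef mulmx0 mul0mx.
rewrite -mxrank_tr; apply/esym/dimv_colspace => phi.
rewrite (@memv_Hom _ _ _ P (simple_mod k Q j)).
apply/idP/submxP => [hphi|[z zE]].
  have fullT : row_full T.
    have [//|p pE] := @path_word _ _ acyclicQ j [::].
    apply/row_fullP; exists (delta_mx 0 p); rewrite -rowE; apply/matrixP => i l.
    by rewrite !mxE pE eqxx !ord1.
  have [alpha halpha alphaT] := projP A (simple_mod k Q j) T phi (top_coef_hom k Q j) fullT hphi.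
  have [|y yE] := @hom_of_surj alpha; first by rewrite (@memv_Hom _ _ _ P A).
  by exists y^T; rewrite -trmx_mul PsiE yE alphaT.
have -> : phi = hom_of z^T *m T by rewrite -PsiE -[phi]trmxK zE trmx_mul trmxK.
have /(@is_homP _ _ _ P A) hz : @is_hom _ _ _ P A (hom_of z^T).
  by rewrite -(@memv_Hom _ _ _ P A) hom_of_hom.
have /(@is_homP _ _ _ A (simple_mod k Q j)) hT := top_coef_hom k Q j.
apply/(@is_homP _ _ _ P (simple_mod k Q j)) => x.
by rewrite -mulmxA hT !mulmxA hz.
Qed.

End NakayamaCoordinates.

(** * Sums over submodules *)

Section SubmoduleSums.
Variables (k : finFieldType) (m : nat) (Q : quiver m).
Local Notation kmod := (kmod k Q).
Implicit Types (K M N : kmod) (a b : Q) (i j : 'I_m).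

Lemma submodsP M (U : 'M[k]_(mdim M)) :
  reflect (<<U>>%MS = U /\ forall x, stablemx U (mact M x)) (U \in submods M).
Proof.
rewrite inE; apply: (iffP andP) => -[/eqP gU stU]; split=> //; first exact/forallP.
exact/forallP.
Qed.

Lemma sum_submods_sub (V : nmodType) K M (u : 'M[k]_(mdim K, mdim M))
    (F : 'M[k]_(mdim M) -> V) :
  is_hom u -> row_free u ->
  \sum_(U in submods M | (U <= u)%MS) F U
  = \sum_(U in submods K) F <<U *m u>>%MS.
Proof.
move=> /is_homP hu free_u.
rewrite (reindex_onto (fun U : 'M[k]_(mdim K) => <<U *m u>>%MS)
    (fun U => <<U *m pinvmx u>>%MS)) /=; last first.
  move=> U /andP[/submodsP[gU _] Uu]; rewrite -[RHS]gU.
  by apply/genmxP; rewrite !(eqmxMr _ (genmxE _)) mulmxKpV ?submx_refl.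
apply: eq_bigl => U; apply/andP/submodsP => [[/andP[/submodsP[_ stU] _] /eqP gU]|[gU stU]].
  split=> [|x]; first by rewrite -gU genmx_id.
  have := stU x; rewrite (eqmxMr _ (genmxE _)) genmxE -mulmxA hu mulmxA.
  by rewrite submxMfree.
split; last first.
  rewrite -[X in _ == X]gU; apply/eqP/genmxP.
  by rewrite !(eqmxMr _ (genmxE _)) -mulmxA mulmxVp // mulmx1 submx_refl.
rewrite genmxE submxMl andbT; apply/submodsP; rewrite genmx_id; split=> // x.
by rewrite (eqmxMr _ (genmxE _)) genmxE -mulmxA hu mulmxA submxMr.
Qed.

Lemma dimv_sub_image K M (u : 'M[k]_(mdim K, mdim M)) (U : 'M[k]_(mdim K)) :
  is_hom u -> row_free u -> dimv_sub <<U *m u>>%MS = dimv_sub U.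
Proof.
move=> /is_homP hu free_u; apply/colP => i; rewrite !mxE.
by rewrite (eqmxMr _ (genmxE _)) -mulmxA hu mulmxA mxrankMfree.
Qed.

Definition preim_mx n p (f : 'M[k]_(n, p)) (U : 'M[k]_p) : 'M[k]_n :=
  kermx (f *m cokermx U).

Lemma sub_preim_mx n p r (f : 'M[k]_(n, p)) (U : 'M[k]_p) (V : 'M[k]_(r, n)) :
  (V <= preim_mx f U)%MS = (V *m f <= U)%MS.
Proof. by rewrite sub_kermx mulmxA -submxE. Qed.

Lemma preim_mxK n p (f : 'M[k]_(n, p)) (U : 'M[k]_p) :
  row_full f -> (preim_mx f U *m f :=: U)%MS.
Proof.
move=> full_f; apply/eqmxP; rewrite -sub_preim_mx submx_refl /=.
rewrite -{1}[U]mulmx1 -(mulVpmx full_f) mulmxA submxMr //.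
by rewrite sub_preim_mx -mulmxA mulVpmx // mulmx1.
Qed.

Lemma preim_mx_image n p (f : 'M[k]_(n, p)) (U : 'M[k]_n) (W : 'M[k]_p) :
  (kermx f <= U)%MS -> (W :=: U *m f)%MS -> (preim_mx f W :=: U)%MS.
Proof.
move=> kerU WU; apply/eqmxP; rewrite sub_preim_mx WU submx_refl andbT.
have /submxP[z zE] : (preim_mx f W *m f <= U *m f)%MS by rewrite -WU -sub_preim_mx.
rewrite -[preim_mx f W](subrK (z *m U)) addmx_sub ?submxMl //.
apply: submx_trans kerU; apply/sub_kermxP.
by rewrite mulmxBl zE mulmxA subrr.
Qed.

Lemma sum_submods_quo (V : nmodType) M N (p : 'M[k]_(mdim M, mdim N))
    (F : 'M[k]_(mdim M) -> V) :
  is_hom p -> row_full p ->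
  \sum_(U in submods M | (kermx p <= U)%MS) F U
  = \sum_(U in submods N) F <<preim_mx p U>>%MS.
Proof.
move=> /is_homP hp full_p.
rewrite (reindex_onto (fun U : 'M[k]_(mdim N) => <<preim_mx p U>>%MS)
    (fun U => <<U *m p>>%MS)) /=; last first.
  move=> U /andP[/submodsP[gU _] kerU]; rewrite -[RHS]gU.
  by apply/genmxP/eqmxP; apply: preim_mx_image => //; apply: genmxE.
apply: eq_bigl => U; apply/andP/submodsP => [[/andP[/submodsP[_ stU] _] /eqP gU]|[gU stU]].
  split=> [|x]; first by rewrite -gU genmx_id.
  have := stU x; rewrite (eqmxMr _ (genmxE _)) genmxE sub_preim_mx -mulmxA -hp mulmxA.
  by rewrite (eqmxMr _ (preim_mxK _ full_p)).
split; last first.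
  rewrite -[X in _ == X]gU; apply/eqP/genmxP.
  by rewrite !(eqmxMr _ (genmxE _)) !(preim_mxK _ full_p) submx_refl.
rewrite genmxE sub_preim_mx mulmx_ker sub0mx andbT.
apply/submodsP; rewrite genmx_id; split=> // x.
rewrite (eqmxMr _ (genmxE _)) genmxE sub_preim_mx -mulmxA -hp mulmxA.
by rewrite (eqmxMr _ (preim_mxK _ full_p)).
Qed.

Lemma dimv_sub_preim M N (p : 'M[k]_(mdim M, mdim N)) (U : 'M[k]_(mdim N)) :
  is_hom p -> row_full p -> U \in submods N ->
  dimv_sub <<preim_mx p U>>%MS = dimv_sub U + dimvr (kermx p).
Proof.
move=> hp full_p /submodsP[_ stU].
have -> : dimv_sub <<preim_mx p U>>%MS = dimvr (preim_mx p U).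
  by apply: dimvr_eqmx; apply: genmxE.
rewrite (dimvr_hom hp) => [|i].
  rewrite (dimvr_eqmx (preim_mxK U full_p)); congr (_ + _).
  apply: dimvr_eqmx; apply/eqmxP; rewrite capmxSr sub_capmx submx_refl andbT.
  by rewrite sub_preim_mx mulmx_ker sub0mx.
move/is_homP: hp => hp; rewrite sub_preim_mx -mulmxA -hp mulmxA.
by rewrite (eqmxMr _ (preim_mxK _ full_p)).
Qed.

Lemma dimv_sub_le M (U : 'M[k]_(mdim M)) i : 0 <= dimv_sub U i 0 <= dimv M i 0.
Proof. by rewrite dimvE mxE !lez_nat mxrankM_maxr. Qed.

End SubmoduleSums.

(** * The Euler form on projective and injective modules *)

Section EulerVectors.
Variables (k : finFieldType) (m : nat) (Q : quiver m).
Hypothesis acyclicQ : acyclic Q.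
Local Notation kmod := (kmod k Q).
Local Notation C := (euler_mx Q).
Implicit Types (M N P X : kmod) (i j : 'I_m) (x y z : 'cV[int]_m).

Definition dotv x y : int := (x^T *m y) 0 0.

Lemma dotvE x y : dotv x y = \sum_i x i 0 * y i 0.
Proof. by rewrite /dotv mxE; apply: eq_bigr => i _; rewrite mxE. Qed.

Lemma lform_dotl x y : lform C x y = dotv (C^T *m x) y.
Proof. by rewrite /dotv trmx_mul trmxK. Qed.

Lemma lform_dotr x y : lform C x y = dotv x (C *m y).
Proof. by rewrite /dotv mulmxA. Qed.

Lemma dotvDr x y z : dotv x (y + z) = dotv x y + dotv x z.
Proof. by rewrite /dotv mulmxDr mxE. Qed.

Lemma dotvC x y : dotv x y = dotv y x.
Proof. by rewrite !dotvE; apply: eq_bigr => i _; rewrite mulrC. Qed.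

Lemma dotv_mono x y z : (forall i, 0 <= x i 0) ->
  (forall i, y i 0 <= z i 0) -> dotv x y <= dotv x z.
Proof. by move=> x0 yz; rewrite !dotvE; apply: ler_sum => i _; apply: ler_wpM2l. Qed.

Lemma dotvBr x y z : dotv x (y - z) = dotv x y - dotv x z.
Proof. by rewrite /dotv mulmxBr !mxE. Qed.

Lemma dotv_squeeze x y z :
  (forall i, 0 <= x i 0) -> (forall i, 0 <= y i 0 <= z i 0) ->
  dotv x z = 0 -> dotv x y = 0.
Proof.
move=> x0 yz xz; apply/eqP; rewrite Order.POrderTheory.eq_le; apply/andP; split.
  by rewrite -xz; apply: dotv_mono => // i; case/andP: (yz i).
have <- : dotv x 0 = 0 by rewrite /dotv mulmx0 mxE.
by apply: dotv_mono => // i; rewrite mxE; case/andP: (yz i).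
Qed.

Lemma dimv_simple j : dimv (simple_mod k Q j) = delta_mx j 0.
Proof.
apply/colP => i; rewrite dimvE [RHS]mxE eqxx andbT /=.
by case: eqP => _; rewrite ?mxrank1 // raddf0 mxrank0.
Qed.

Lemma delta_dotv j x : dotv (delta_mx j 0) x = x j 0.
Proof. by rewrite /dotv trmx_delta -rowE mxE. Qed.

Lemma dimv_top_ge0 P i : 0 <= dimv_top P i 0.
Proof. by rewrite -dimHom_to_simple. Qed.

(** The entry at j of each side is the dimension of the space of homomorphisms
    from P to the simple module at j. *)
Lemma euler_top P :
  (forall N, ext_vanish P N) -> C^T *m dimv P = dimv_top P.
Proof.
move=> extP; apply/colP => j; rewrite -dimHom_to_simple // dimHom_euler //.
by rewrite dimv_simple lform_dotl dotvC delta_dotv.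
Qed.

Lemma euler_soc X :
  (forall N, ext_vanish N X) -> C *m dimv X = dimv_sub (soc X).
Proof.
move=> extX; apply/colP => j; rewrite -dimHom_from_simple // dimHom_euler //.
by rewrite dimv_simple lform_dotr delta_dotv.
Qed.

Lemma ext_vanish_nu P N : ext_vanish N (nu P).
Proof.
by have [s sP] := nu_split acyclicQ P; exact: (split_ext_vanish acyclicQ (N := nu P) sP).
Qed.

Lemma euler_nu P : projective P -> C *m dimv (nu P) = dimv_top P.
Proof.
move=> projP; rewrite euler_soc; last exact: ext_vanish_nu.
by apply/colP => j; rewrite -dimHom_from_simple // dimHom_nu_simple // dimHom_to_simple.
Qed.

Lemma dimHom_gt0P M N :
  reflect (exists2 F : 'M[k]_(mdim M, mdim N), is_hom F & F != 0) (0 < dimHom M N)%N.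
Proof.
rewrite lt0n dimv_eq0; apply: (iffP idP) => [H0|[F hF F0]].
  by exists (vpick (Hom M N)); rewrite ?vpick0 // -memv_Hom memv_pick.
by apply: contra F0 => /eqP H0; rewrite -memv0 -H0 memv_Hom.
Qed.

End EulerVectors.

(** * Exchange matrices and characters in terms of the Euler form *)

Section ExchangeMatricesEuler.
Variables (k : finFieldType) (m n : nat) (le_nm : (n <= m)%N) (Q : quiver m).
Local Notation C := (euler_mx Q).
Local Notation W := (Itilde m n).
Local Notation w := (widen_ord le_nm).

Lemma mul_Itilde r (A : 'M[int]_(r, m)) i j : (A *m W) i j = A i (w j).
Proof.
rewrite mxE (bigD1 (w j)) //= mxE eqxx mulr1 big1 ?addr0 // => l ne.
by rewrite mxE -[_ == _]/(l == w j) (negPf ne) mulr0.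
Qed.

(** Vectors supported on the unfrozen vertices are determined by their unfrozen
    coordinates. *)
Lemma Itilde_rowsub (x : 'cV[int]_m) :
  (forall i : 'I_m, (n <= i)%N -> x i 0 = 0) -> W *m rowsub w x = x.
Proof.
move=> x0; apply/colP => i; rewrite mxE.
case: (ltnP i n) => [lt_in|le_ni]; last first.
  rewrite x0 // big1 // => j _; rewrite mxE.
  by rewrite gtn_eqF ?mul0r // (leq_trans (ltn_ord j) le_ni).
rewrite (bigD1 (Ordinal lt_in)) //= !mxE eqxx mul1r big1 ?addr0 => [|j ne].
  by congr (x _ 0); apply: val_inj.
rewrite mxE; case: eqP => [e|]; last by rewrite mul0r.
by case/eqP: ne; apply: val_inj.
Qed.

Lemma dimHom_simple_simple (i j : 'I_m) :
  dimHom (simple_mod k Q i) (simple_mod k Q j) = (i == j).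
Proof.
have [<-|ne] := eqVneq i j.
  transitivity (\dim {: 'M[k]_(1, 1)}); last by rewrite dimvf /dim /= muln1.
  congr (\dim _); apply/vspaceP => F; rewrite memvf.
  rewrite (@memv_Hom _ _ _ (simple_mod k Q i) (simple_mod k Q i)).
  apply/(@is_homP _ _ _ (simple_mod k Q i) (simple_mod k Q i)) => x.
  by apply/matrixP => r s; rewrite !mxE !big_ord1 mulrC !ord1.
apply/eqP; rewrite eqn0Ngt; apply/(dimHom_gt0P (simple_mod k Q i)) => -[F].
move=> /is_hom_to_simpleP[<- _].
by rewrite /= [j == i]eq_sym (negPf ne) raddf0 mul0mx eqxx.
Qed.

Lemma euler_simple (i j : 'I_m) :
  euler (simple_mod k Q i) (simple_mod k Q j) = C i j.
Proof.
rewrite /euler dimHom_simple_simple dimExt1_simple mxE.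
by case: (i == j).
Qed.

Lemma sub_Itilde_Rtilde : W - Rtilde k le_nm Q = C *m W.
Proof.
apply/matrixP => i j; rewrite mul_Itilde !mxE dimExt1_simple.
by rewrite -[val i == val j]/(i == w j).
Qed.

Lemma Btilde_euler : Btilde le_nm Q = (C - C^T) *m W.
Proof.
apply/matrixP => i j; rewrite mul_Itilde !mxE /narrows eq_sym.
by rewrite opprB addrC addrA subrK addrC.
Qed.

Lemma eulerv_lform (e f : 'cV[int]_n) :
  eulerv k le_nm Q e f = lform C (W *m e) (W *m f).
Proof.
have WCW : W^T *m C *m W = \matrix_(i, j) C (w i) (w j).
  apply/matrixP => i j; rewrite mul_Itilde -[W^T *m C]trmxK mxE trmx_mul trmxK.
  by rewrite mul_Itilde !mxE.
rewrite /lform trmx_mul !mulmxA -[e^T *m _ *m C]mulmxA -[e^T *m _ *m W]mulmxA WCW.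
rewrite -mulmxA mxE; apply: eq_bigr => i _; rewrite !mxE mulr_sumr.
apply: eq_bigr => j _; rewrite euler_simple [X in _ = _ * (X * _)]mxE.
by rewrite -mulrA [f j 0 * _]mulrC.
Qed.

End ExchangeMatricesEuler.

Lemma lform_compatible (m n : nat) (le_nm : (n <= m)%N) (Q : quiver m)
    (Lam : 'M[int]_m) (x y : 'cV[int]_m) :
  Lam *m (- Btilde le_nm Q) = Itilde m n ->
  (forall i : 'I_m, (n <= i)%N -> y i 0 = 0) ->
  lform Lam x ((euler_mx Q - (euler_mx Q)^T) *m y) = - dotv x y.
Proof.
move=> compatL /(Itilde_rowsub le_nm) yE.
rewrite -{1}yE mulmxA -Btilde_euler /lform -mulmxA [Lam *m _]mulmxA.
rewrite -[Lam *m Btilde _ _]opprK -mulmxN compatL mulNmx yE mulmxN.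
by rewrite mxE.
Qed.

Lemma dimv_top_zero (k : finFieldType) (m : nat) (Q : quiver m) :
  dimv_top (zero_mod k Q) = 0.
Proof.
apply/colP => i; rewrite !mxE.
by rewrite [1%:M *m _]flatmx0 [rad _ *m _]flatmx0 subrr.
Qed.

Section CalderoChapotonSum.
Variables (k : finFieldType) (v : sqrt_card k) (m n : nat) (le_nm : (n <= m)%N).
Variables (Q : quiver m) (Lam : 'M[int]_m).
Local Notation C := (euler_mx Q).
Local Notation W := (Itilde m n).
Local Notation w := (widen_ord le_nm).
Local Notation kmod := (kmod k Q).

Definition qmono (c : int) (e : 'cV[int]_m) : qtorus v Lam := qpow v c *: Xmon v Lam e.

Lemma eq_qmono c d e f : c = d -> e = f -> qmono c e = qmono d f.
Proof. by move=> -> ->. Qed.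

Lemma qmonoM c d e f :
  qmono c e * qmono d f = qmono (c + d + lform Lam e f) (e + f).
Proof.
by rewrite /qmono -scalerAl -scalerAr XmonM !scalerA -!qpowD.
Qed.

Lemma qpow_qmono c d e : qpow v c *: qmono d e = qmono (c + d) e.
Proof. by rewrite /qmono scalerA -qpowD. Qed.

Lemma Xmon_qmono e : Xmon v Lam e = qmono 0 e.
Proof. by rewrite /qmono qpow0 scale1r. Qed.

(** The character as a sum over submodules instead of dimension vectors, with
    all vectors in the larger lattice. *)
Lemma Xcc_submods (M P : kmod) :
  (forall i : 'I_m, (n <= i)%N -> dimv M i 0 = 0) ->
  Xcc v le_nm Lam M P
  = \sum_(U in submods M)
      qmono (- lform C (dimv_sub U) (dimv M - dimv_sub U))
            ((C - C^T) *m dimv_sub U - C *m dimv M + dimv_top P).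
Proof.
move=> M0; pose deg (U : 'M[k]_(mdim M)) : {ffun 'I_n -> 'I_(mdim M).+1} :=
  [ffun i => inord (\rank (U *m mact M (inl (w i))))].
rewrite (partition_big deg predT) //=; apply: eq_bigr => d _.
have degE (U : 'M[k]_(mdim M)) :
    (deg U == d) = (rowsub w (dimv_sub U) == \col_i (d i)%:Z).
  apply/eqP/eqP => [<-|eqU].
    by apply/colP => i; rewrite !mxE ffunE inordK // ltnS rank_leq_row.
  apply/ffunP => i; rewrite ffunE; apply/val_inj.
  move/colP/(_ i): eqU; rewrite !mxE => -[rk_di].
  by rewrite /= inordK ?ltnS ?rank_leq_row // rk_di.
cbv zeta; have -> : #|Gr le_nm M (\col_i (d i)%:Z)| = #|[set U in submods M | deg U == d]|.
  by apply: eq_card => U; rewrite !inE degE.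
rewrite -scalerA scaler_nat -sumr_const; apply/esym/eq_big => [U|U].
  by rewrite inE.
move=> /andP[_]; rewrite degE => /eqP <-.
have WM : W *m udim le_nm M = dimv M by apply: Itilde_rowsub.
have WU : W *m rowsub w (dimv_sub U) = dimv_sub U.
  apply: Itilde_rowsub => i /M0 Mi0; apply/eqP.
  by have := dimv_sub_le U i; rewrite Mi0 Order.POrderTheory.eq_le andbC.
by rewrite eulerv_lform mulmxBr sub_Itilde_Rtilde Btilde_euler -!mulmxA WM WU.
Qed.

Lemma qpow_Xcc_submods (M P : kmod) c :
  (forall i : 'I_m, (n <= i)%N -> dimv M i 0 = 0) ->
  qpow v c *: Xcc v le_nm Lam M P
  = \sum_(U in submods M)
      qmono (c - lform C (dimv_sub U) (dimv M - dimv_sub U))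
            ((C - C^T) *m dimv_sub U - C *m dimv M + dimv_top P).
Proof.
move=> M0; rewrite Xcc_submods // scaler_sumr.
by apply: eq_bigr => U _; rewrite qpow_qmono.
Qed.

Lemma Xshift_Xmod_submods (M P : kmod) :
  Lam *m (- Btilde le_nm Q) = W ->
  (forall i : 'I_m, (n <= i)%N -> dimv M i 0 = 0) ->
  Xshift v le_nm Lam P * Xmod v le_nm Lam M
  = \sum_(U in submods M)
      qmono (lform Lam (dimv_top P) (- (C *m dimv M)) - dotv (dimv_top P) (dimv_sub U)
               - lform C (dimv_sub U) (dimv M - dimv_sub U))
            ((C - C^T) *m dimv_sub U - C *m dimv M + dimv_top P).
Proof.
move=> compatL M0; rewrite XshiftE Xmon_qmono /Xmod Xcc_submods // mulr_sumr.
apply: eq_bigr => U subU; rewrite qmonoM dimv_top_zero addr0 add0r.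
have U0 (i : 'I_m) : (n <= i)%N -> dimv_sub U i 0 = 0.
  move=> /M0 Mi; have := dimv_sub_le U i; rewrite Mi => Ui.
  by apply/eqP; rewrite Order.POrderTheory.eq_le andbC.
rewrite (lformDr Lam) (lform_compatible _ compatL U0) [dimv_top P + _]addrC.
apply: eq_qmono; last exact: erefl.
by rewrite addrC [- dotv _ _ + _]addrC.
Qed.

End CalderoChapotonSum.

(** * The exchange relation *)

Section Exchange.
Variables (k : finFieldType) (m : nat) (Q : quiver m).
Hypothesis acyclicQ : acyclic Q.
Local Notation C := (euler_mx Q).
Local Notation kmod := (kmod k Q).
Implicit Types (M N P K : kmod).

Lemma dotv_dimHom_projective P N : projective P ->
  dotv (dimv_top P) (dimv N) = (dimHom P N)%:Z.
Proof.
move=> projP; have extP X : ext_vanish P X by apply: projective_ext_vanish.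
by rewrite -euler_top // -lform_dotl dimHom_euler.
Qed.

Lemma dotv_dimHom_nu P N : projective P ->
  dotv (dimv_top P) (dimv N) = (dimHom N (nu P))%:Z.
Proof.
move=> projP; rewrite dimHom_euler; last exact: ext_vanish_nu.
by rewrite lform_dotr euler_nu // dotvC.
Qed.

Lemma dimvr_mono M r s (U : 'M[k]_(r, mdim M)) (V : 'M[k]_(s, mdim M)) i :
  (U <= V)%MS -> dimvr U i 0 <= dimvr V i 0.
Proof. by move=> UV; rewrite !mxE lez_nat mxrankS // submxMr. Qed.

Variables (P M : kmod) (f : 'M[k]_(mdim P, mdim M)) (g : 'M[k]_(mdim M, mdim (nu P))).
Hypotheses (projP : projective P) (dimPM : dimHom P M = 1%N).
Hypotheses (hom_f : is_hom f) (f_neq0 : f != 0) (hom_g : is_hom g) (g_neq0 : g != 0).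

(** The left side is the dimension of Hom(P, U), which is a subspace of the line
    Hom(P, M) spanned by f. *)
Lemma dotv_top_submod (U : 'M[k]_(mdim M)) : U \in submods M ->
  dotv (dimv_top P) (dimv_sub U) = (f <= U)%MS.
Proof.
move=> /submodsP[_ stU]; have [K [u [hom_u free_u uU]]] := exists_submodule stU.
have dimU : dimv_sub U = dimv K.
  by rewrite -(dimvr_row_free hom_u free_u); apply: dimvr_eqmx; apply: eqmx_sym.
have le1 : dotv (dimv_top P) (dimv_sub U) <= 1.
  have <- : dotv (dimv_top P) (dimv M) = 1 by rewrite dotv_dimHom_projective // dimPM.
  apply: dotv_mono => i; first exact: dimv_top_ge0.
  by case/andP: (dimv_sub_le U i).
move: le1; rewrite dimU dotv_dimHom_projective // lez_nat => le1; congr Posz.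
apply/eqP; move: le1; rewrite leq_eqVlt ltnS leqn0; case: (boolP (f <= U)%MS) => [fU|nfU].
  case/orP => [//|]; rewrite eqn0Ngt => /negP[]; apply/dimHom_gt0P.
  have [f' fE] : exists f', f' *m u = f by exists (f *m pinvmx u); rewrite mulmxKpV ?uU.
  exists f'; last by apply: contra f_neq0 => /eqP f0; rewrite -fE f0 mul0mx.
  apply/is_homP => x; apply: (row_free_inj free_u).
  move/is_homP: hom_u => hu; move/is_homP: hom_f => hf.
  by rewrite -mulmxA -hu mulmxA fE hf -mulmxA fE.
rewrite orbC => /orP[//|/eqP K1]; case/negP: nfU.
have /dimHom_gt0P[F hom_F F0] : (0 < dimHom P K)%N by rewrite K1.
have Fu0 : F *m u != 0.
  apply: contra F0 => /eqP Fu0; apply/eqP/(row_free_inj free_u).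
  by rewrite Fu0 mul0mx.
have hom_Fu : is_hom (F *m u).
  apply/is_homP => x; move/is_homP: hom_u => hu; move/is_homP: hom_F => hF.
  by rewrite -mulmxA hu mulmxA hF mulmxA.
have homM : Hom P M = <[f]>%VS.
  apply/esym/eqP; rewrite eqEdim -memvE memv_Hom hom_f /=.
  by rewrite dim_vline f_neq0 -/(dimHom P M) dimPM.
have : F *m u \in <[f]>%VS by rewrite -homM memv_Hom.
case/vlineP => c Fuc; have c0 : c != 0.
  by apply: contra Fu0 => /eqP c0; rewrite Fuc c0 scale0r.
rewrite -uU -[f]scale1r -(mulVf c0) -scalerA -Fuc.
by rewrite scalemx_sub // submxMl.
Qed.

(** The inclusion of the image of g in nu P is nonzero, so the pairing of the top
    of P with dim (im g) is at least 1, while its pairing with dim M is 1. *)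
Lemma dotv_top_ker : dotv (dimv_top P) (dimvr (kermx g)) = 0.
Proof.
have stg x : stablemx g (mact (nu P) x).
  by move/is_homP: hom_g => ->; apply: submxMl.
have [K [u [hom_u free_u ug]]] := exists_submodule stg.
have top_g : 1 <= dotv (dimv_top P) (dimvr g).
  have -> : dimvr g = dimv K.
    by rewrite -(dimvr_row_free hom_u free_u); apply: dimvr_eqmx; apply: eqmx_sym.
  rewrite dotv_dimHom_nu // lez_nat; apply/dimHom_gt0P; exists u => //.
  by rewrite -mxrank_eq0 ug mxrank_eq0.
apply/eqP; rewrite Order.POrderTheory.eq_le; apply/andP; split.
  have : dotv (dimv_top P) (dimv M) = 1 by rewrite dotv_dimHom_projective // dimPM.
  rewrite (dimv_hom hom_g) dotvDr => top_M.
  by rewrite -(lerD2l (dotv (dimv_top P) (dimvr g))) top_M addr0.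
rewrite -[X in X <= _](_ : dotv (dimv_top P) 0 = 0); last first.
  by rewrite /dotv mulmx0 mxE.
apply: dotv_mono => i; first exact: dimv_top_ge0.
by rewrite !mxE.
Qed.

(** If U does not contain the image of f, then Hom(U, nu P), which has the same
    dimension as Hom(P, U), is zero. *)
Lemma sub_kermx_submod (U : 'M[k]_(mdim M)) : U \in submods M ->
  (U <= kermx g)%MS = ~~ (f <= U)%MS.
Proof.
move=> subU; have topU := dotv_top_submod subU; apply/idP/idP => [Ug|nfU].
  apply/negP => fU.
  have : dotv (dimv_top P) (dimv_sub U) <= dotv (dimv_top P) (dimvr (kermx g)).
    apply: dotv_mono => i; first exact: dimv_top_ge0.
    exact: dimvr_mono.
  by rewrite dotv_top_ker topU fU.
have /submodsP[_ stU] := subU; have [K [u [hom_u free_u uU]]] := exists_submodule stU.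
have dimU : dimv_sub U = dimv K.
  by rewrite -(dimvr_row_free hom_u free_u); apply: dimvr_eqmx; apply: eqmx_sym.
rewrite (negPf nfU) dimU dotv_dimHom_nu // in topU.
rewrite -uU sub_kermx; apply: contraT => ug0.
have : (0 < dimHom K (nu P))%N.
  apply/dimHom_gt0P; exists (u *m g) => //; apply/is_homP => x.
  move/is_homP: hom_u => hu; move/is_homP: hom_g => hg.
  by rewrite -mulmxA hg mulmxA hu mulmxA.
by case: topU => ->.
Qed.

End Exchange.

Lemma subrBD (V : zmodType) (x y s t : V) : x - (t - s + y) + t = x - y + s.
Proof.
rewrite !opprD opprK -!addrA; congr (_ + _).
by rewrite addrCA [- y + t]addrC addKr addrC.
Qed.

Lemma addrBBD (V : zmodType) (x y z s t : V) :
  x + (z - (t - s)) - (y + z) + t = x - y + s.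
Proof.
rewrite -(subrBD x y s t); congr (_ + t); move: (t - s) => w.
by rewrite !opprD addrACA [z - _ - z]addrAC subrr add0r -addrA [- y - w]addrC.
Qed.

Theorem theorem3p8
  (k : finFieldType) (v : sqrt_card k)
  (m n : nat) (n_gt0 : (0 < n)%N) (le_nm : (n <= m)%N)
  (Q : quiver m) (acyclicQ : acyclic Q)
  (Lam : 'M[int]_m) (antisymL : Lam^T = - Lam)
  (compatL : Lam *m (- Btilde le_nm Q) = Itilde m n)
  (M P : kmod k Q) (unfrozenM : unfrozen n M) (projP : projective P)
  (dimPM : dimHom P M = 1%N) (dimMI : dimHom M (nu P) = 1%N)
  (P' A B I' : kmod k Q)
  (f : 'M[k]_(mdim P, mdim M)) (g : 'M[k]_(mdim M, mdim (nu P)))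
  (f_neq0 : f != 0) (g_neq0 : g != 0)
  (iP' : 'M[k]_(mdim P', mdim P)) (pA : 'M[k]_(mdim M, mdim A))
  (exact_f : exact4 iP' f pA)
  (iB : 'M[k]_(mdim B, mdim M)) (pI' : 'M[k]_(mdim (nu P), mdim I'))
  (exact_g : exact4 iB g pI')
  (* I'[-1] = PI'[1] *)
  (PI' : kmod k Q) (projPI' : projective PI') (topPI' : top_iso_soc PI' I')
  (HomBI' : Hom B I' = 0%VS) (HomP'A : Hom P' A = 0%VS) :
  let z := lform Lam (dimv_top P)
             (- ((Itilde m n - Rtilde k le_nm Q) *m udim le_nm M)) in
  Xshift v le_nm Lam P * Xmod v le_nm Lam M
  = qpow v z *: Xcc v le_nm Lam B PI' + qpow v (z - 1) *: Xcc v le_nm Lam A P'.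
Proof.
move=> z; pose C := euler_mx Q; pose t := dimv_top P.
have [dimP dimM_A] := exact4_dimv exact_f.
have [dimM_B dimI] := exact4_dimv exact_g.
case: exact_f => -[hom_iP' hom_f hom_pA] free_iP' _ fE full_pA.
case: exact_g => -[hom_iB hom_g hom_pI'] free_iB iBE _ full_pI'.
have M0 (i : 'I_m) : (n <= i)%N -> dimv M i 0 = 0.
  by move=> le_ni; rewrite dimvE unfrozenM // mxrank0.
have dimvr_ge0 N r (U : 'M[k]_(r, mdim N)) i : 0 <= (dimvr U) i 0 by rewrite mxE.
have dim_ge0 (N : kmod k Q) i : 0 <= dimv N i 0 by rewrite mxE.
have B0 (i : 'I_m) : (n <= i)%N -> dimv B i 0 = 0.
  move=> /M0; rewrite dimM_B mxE => /eqP; rewrite paddr_eq0 // => /andP[_ /eqP //].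
have A0 (i : 'I_m) : (n <= i)%N -> dimv A i 0 = 0.
  move=> /M0; rewrite dimM_A mxE => /eqP; rewrite paddr_eq0 // => /andP[/eqP //].
have zE : z = lform Lam t (- (C *m dimv M)).
  by rewrite /z sub_Itilde_Rtilde -mulmxA Itilde_rowsub.
have extP N : ext_vanish P N by apply: projective_ext_vanish.
have extP' N : ext_vanish P' N by apply: ext_vanish_sub hom_iP' free_iP' (extP N).
have extI' N : ext_vanish N I'.
  by apply: ext_vanish_quo hom_pI' full_pI' _; apply: ext_vanish_nu.
have topP : C^T *m dimv P = t by apply: euler_top.
have topP' : C^T *m dimv P' = dimv_top P' by apply: euler_top.
have socI : C *m dimv (nu P) = t by apply: euler_nu.
have socI' : C *m dimv I' = dimv_top PI'.
  by rewrite (top_iso_soc_dimv topPI'); apply: euler_soc.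
have topf : C^T *m dimvr f = t - dimv_top P'.
  by rewrite -topP -topP' dimP mulmxDr addrK.
have socg : C *m dimvr g = t - dimv_top PI'.
  by rewrite -socI -socI' dimI mulmxDr addrC addKr.
have BI'0 : dotv (dimv_top PI') (dimv B) = 0.
  by rewrite -socI' dotvC -lform_dotr -dimHom_euler // /dimHom HomBI' dimv0.
have P'A0 : dotv (dimv_top P') (dimv A) = 0.
  by rewrite -topP' -lform_dotl -dimHom_euler // /dimHom HomP'A dimv0.
have top_dim U : U \in submods M -> dotv t (dimv_sub U) = (f <= U)%MS.
  exact: dotv_top_submod.
pose term c (b s u : 'cV[int]_m) : qtorus v Lam :=
  qmono v Lam (c - lform C u (b - u)) ((C - C^T) *m u - C *m b + s).
rewrite Xshift_Xmod_submods // !qpow_Xcc_submods // -zE.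
(* The submodules inside B against those that contain the image of f. *)
rewrite (bigID (fun U => (U <= iB)%MS)) /=; congr (_ + _).
  transitivity (\sum_(U in submods M | (U <= iB)%MS)
      term z (dimv B) (dimv_top PI') (dimv_sub U)).
    apply: eq_bigr => U /andP[subU UB]; set u := dimv_sub U.
    have tu : dotv t u = 0.
      rewrite top_dim //; move: UB; rewrite iBE (sub_kermx_submod acyclicQ projP dimPM hom_f) //.
      by case: (f <= U)%MS.
    have I'u : dotv (dimv_top PI') u = 0.
      apply: dotv_squeeze BI'0 => i; first exact: dimv_top_ge0.
      have /andP[-> _] /= := dimv_sub_le U i; rewrite -(dimvr_row_free hom_iB free_iB).
      exact: (dimvr_mono i UB).
    have ug : lform C u (dimvr g) = 0.
      by rewrite lform_dotr socg dotvBr ![dotv u _]dotvC tu I'u subrr.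
    rewrite /term tu subr0; apply: eq_qmono.
      by rewrite dimM_B -[_ + _ - u]addrA (lformDr C u (dimvr g)) ug add0r.
    by rewrite dimM_B mulmxDr socg subrBD.
  apply: etrans (sum_submods_sub (fun U => term _ _ _ (dimv_sub U)) hom_iB free_iB) _.
  by apply: eq_bigr => U _; rewrite /term dimv_sub_image.
(* A submodule containing the image of f has the dimension vector of its image
   in A plus that of the image of f. *)
transitivity (\sum_(U in submods M | (kermx pA <= U)%MS)
    term (z - 1) (dimv A) (dimv_top P') (dimv_sub U - dimvr f)).
  apply: eq_big => [U|U /andP[subU nUB]].
    apply: andb_id2l => subU.
    by rewrite iBE (sub_kermx_submod acyclicQ projP dimPM hom_f) // negbK fE.
  set u := dimv_sub U; pose y := dimv M - u.
  have fU : (f <= U)%MS.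
    by move: nUB; rewrite iBE (sub_kermx_submod acyclicQ projP dimPM hom_f) // negbK.
  have tu : dotv t u = 1 by rewrite top_dim // fU.
  have yE : y = dimv A - (u - dimvr f) by rewrite /y dimM_A opprB addrA.
  have ty : dotv t y = 0.
    by rewrite dotvBr tu dotv_dimHom_projective // dimPM subrr.
  have P'y : dotv (dimv_top P') y = 0.
    apply: dotv_squeeze P'A0 => i; first exact: dimv_top_ge0.
    apply/andP; split.
      by rewrite /y mxE [(- u) i 0]mxE subr_ge0; case/andP: (dimv_sub_le U i).
    rewrite yE mxE [(- (u - _)) i 0]mxE gerBl mxE [(- dimvr f) i 0]mxE subr_ge0.
    exact: (dimvr_mono i fU).
  have fy : lform C (dimvr f) y = 0.
    by rewrite lform_dotl topf dotvC dotvBr ![dotv y _]dotvC ty P'y subrr.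
  have uy : lform C u (dimv M - u) = lform C (u - dimvr f) (dimv A - (u - dimvr f)).
    by rewrite -yE -/y -{1}(subrK (dimvr f) u) (lformDl C (u - dimvr f)) fy addr0.
  have Bu : (C - C^T) *m u = (C - C^T) *m (u - dimvr f) + (C *m dimvr f - (t - dimv_top P')).
    by rewrite -topf -mulmxBl -mulmxDr subrK.
  rewrite /term tu uy Bu; apply: eq_qmono; first exact: erefl.
  by rewrite dimM_A [C *m (_ + _)]mulmxDr addrBBD.
apply: etrans (sum_submods_quo (fun U => term _ _ _ (dimv_sub U - dimvr f)) hom_pA full_pA) _.
apply: eq_bigr => U subU; have dimU : dimv_sub <<preim_mx pA U>>%MS - dimvr f = dimv_sub U.
  by rewrite dimv_sub_preim // -(dimvr_eqmx fE) addrK.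
by rewrite /term dimU.
Qed.
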